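(* Let $d\ge 1$ and let $W:\mathbb{R}^d\to\mathbb{R}\cup\{+\infty\}$ be a measurable function satisfying all of the following: (1) $W$ is bounded from below by a finite constant $W_{\min}<0$; (2) $W$ is locally integrable, i.e. $\int_B |W|<+\infty$ for every open ball $B\subset\mathbb{R}^d$; (3) $W(x)=W(-x)$ for all $x\in\mathbb{R}^d$; (4) $W$ is lower semi-continuous; (5) there is $R_6>0$ such that, for every $k\in\{1,\dots,d\}$, $W$ is strictly increasing on $\mathbb{R}^{k-1}\times[R_6,\infty)\times\mathbb{R}^{d-k}$ as a function of its $k$-th variable; (6) the limit $W_\infty:=\lim_{|x|\to\infty}W(x)$ exists (possibly equal to $+\infty$), and, if $W_\infty<+\infty$, the positive part of $\tilde W:=W-W_\infty$ is integrable on $\mathbb{R}^d$. Then $E$ admits a global minimiser on $\mathcal{P}(\mathbb{R}^d)$ if and only if there is $\rho\in\mathcal{P}(\mathbb{R}^d)$ with $E(\rho)\le\frac12 W_\infty$.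
   Context: $\mathcal{P}(\mathbb{R}^d)$ denotes the set of (Borel) probability measures on $\mathbb{R}^d$. The interaction energy $E:\mathcal{P}(\mathbb{R}^d)\to\mathbb{R}\cup\{+\infty\}$ is $$E(\rho)=\frac12\int_{\mathbb{R}^d\times\mathbb{R}^d}W(x-y)\,d\rho(x)\,d\rho(y),$$ which is well defined because $W$ is bounded from below. A global minimiser of $E$ is a $\rho\in\mathcal{P}(\mathbb{R}^d)$ with $E(\rho)\le E(\mu)$ for all $\mu\in\mathcal{P}(\mathbb{R}^d)$. *)

(* Defs.v *)
From HB Require Import structures.
From mathcomp Require Import all_boot all_order all_algebra.
From mathcomp Require Import all_classical all_reals all_analysis.
From mathcomp Require Import measurable_realfun.

Set Implicit Arguments.
Unset Strict Implicit.
Unset Printing Implicit Defensive.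

Import Order.TTheory GRing.Theory Num.Theory.
Import numFieldNormedType.Exports.

Local Open Scope classical_set_scope.
Local Open Scope ring_scope.

(* R^n is 'rV[R]_n with the library topology, which is the usual one.  It is
   given its Borel sigma-algebra. *)
Section borel_rV.
Variables (R : realType) (n : nat).

HB.instance Definition _ := @isMeasurable.Build
  (sigma_display (open : set (set 'rV[R]_n))) 'rV[R]_n
  <<s (open : set (set 'rV[R]_n)) >> (@sigma_algebra0 _ setT _) (@sigma_algebraC _ _)
  (@sigma_algebra_bigcup _ setT _).

Lemma open_measurable_rV (U : set 'rV[R]_n) : open U -> measurable U.
Proof. exact: sub_sigma_algebra. Qed.

End borel_rV.

Lemma measurable_coord (R : realType) n (i : 'I_n) :
  measurable_fun [set: 'rV[R]_n] (fun x : 'rV[R]_n => x ord0 i : R).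
Proof.
apply: (measurability _ (RGenOpens.measurableE R)) => //.
move=> _ [_ [a [b ->]] <-]; rewrite setTI; apply: open_measurable_rV.
move: (@coord_continuous R 1 n ord0 i) => /continuousP; apply.
exact: interval_open.
Qed.

Section measurable_fun_rV.
Variables (R : realType) (d : measure_display) (T : measurableType d) (n : nat).

Lemma open_rV_bigcup_ball (U : set 'rV[R]_n) : open U ->
  exists F : 'rV[rat]_n * nat -> set 'rV[R]_n,
    U = \bigcup_p F p /\
    forall p, F p = set0 \/ exists (c : 'rV[R]_n) (e : R), F p = ball c e.
Proof.
move=> oU.
pose B (p : 'rV[rat]_n * nat) : set 'rV[R]_n :=
  ball (map_mx ratr p.1 : 'rV[R]_n) p.2.+1%:R^-1.
exists (fun p => if `[< B p `<=` U >] then B p else set0); split; last first.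
  by move=> p; case: ifPn => _; [right; do 2 eexists | left].
apply/seteqP; split=> [x Ux|x [p _]]; last by case: asboolP => // + Bx; exact.
have /nbhs_ballP[e /= e0 eU] : nbhs x U by exact: open_nbhs_nbhs.
pose k := Num.truncn (2 / e).
have ke : 2 * k.+1%:R^-1 <= e.
  rewrite ler_pdivrMr ?ltr0n// mulrC -ler_pdivrMr// ltW//.
  by rewrite truncnS_gt// divr_ge0// ltW.
have k0 : 0 < k.+1%:R^-1 :> R by rewrite invr_gt0 ltr0n.
have q_ i : exists q : rat, ratr q \in
    `](x ord0 i - k.+1%:R^-1), (x ord0 i + k.+1%:R^-1)[.
  by apply: rat_in_itvoo; rewrite ltrD2l gtrN.
pose q : 'rV[rat]_n := \row_i sval (cid (q_ i)).
have qx : ball (map_mx ratr q : 'rV[R]_n) k.+1%:R^-1 x.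
  split=> // i j; rewrite (ord1 i) !mxE; move: (svalP (cid (q_ j))).
  by rewrite in_itv/= -ltr_distl.
have BU : B (q, k) `<=` U.
  move=> y qy; apply: eU; apply: (@le_ball _ _ _ _ _ ke).
  by rewrite mulr2n mulrDl mul1r; apply: ball_triangle qy; apply: ball_sym.
by exists (q, k) => //; case: asboolP.
Qed.

Lemma measurable_fun_rVP (f : T -> 'rV[R]_n) :
  (forall i, measurable_fun setT (fun t => f t ord0 i : R)) ->
  measurable_fun setT f.
Proof.
move=> mf; apply: (@measurability _ _ _ _ setT f (@open 'rV[R]_n)) => //.
move=> _ [U oU <-]; rewrite setTI.
have [F [-> Fball]] := open_rV_bigcup_ball oU.
rewrite preimage_bigcup; apply: countable_bigcupT_measurable => // p.
have [->|[c [e ->]]] := Fball p; first by rewrite preimage_set0.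
have [e0|e0] := ltP 0 e; last first.
  rewrite (_ : _ @^-1` _ = set0)// -subset0 => t [e0'].
  by move: e0; rewrite leNgt e0'.
rewrite (_ : _ @^-1` _ = \bigcap_(i in [set: 'I_n])
    ((fun t => f t ord0 i : R) @^-1` ball (c ord0 i) e)); last first.
  apply/seteqP; split=> [t [_ ft] i _|t ft]; first exact: ft.
  by split=> // j i; rewrite ord1; exact: ft.
apply: fin_bigcap_measurable => // i _; rewrite -[X in measurable X]setTI.
by apply: mf => //; apply: open_measurable; exact: ball_open.
Qed.

End measurable_fun_rV.

(* Lebesgue measure on R^n, by induction on n as the product of the Lebesgue
   measures on R and R^n, carried to R^n.+1 by (a, x) |-> (a, x_1, ..., x_n);
   lebesgue_rV_box gives its value on boxes. *)
Section lebesgue_rV.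
Variable R : realType.

Definition cons_rV n (p : measurableTypeR R * 'rV[R]_n) : 'rV[R]_n.+1 :=
  \row_i oapp (p.2 ord0) p.1 (unlift ord0 i).

Definition uncons_rV n (x : 'rV[R]_n.+1) : measurableTypeR R * 'rV[R]_n :=
  (x ord0 ord0, \row_i x ord0 (lift ord0 i)).

Lemma cons_rVK n : cancel (@cons_rV n) (@uncons_rV n).
Proof.
move=> [a x]; congr pair; rewrite ?mxE ?unlift_none//.
by apply/rowP => i; rewrite !mxE liftK.
Qed.

Lemma uncons_rVK n : cancel (@uncons_rV n) (@cons_rV n).
Proof.
by move=> x; apply/rowP => i; rewrite mxE; case: unliftP => [j|] -> //=; rewrite mxE.
Qed.

Lemma measurable_cons_rV n : measurable_fun setT (@cons_rV n).
Proof.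
apply: measurable_fun_rVP => i.
under eq_fun do rewrite mxE.
case: unliftP => [j _|_] /=; last exact: measurable_fst.
exact: (measurableT_comp (measurable_coord j) measurable_snd).
Qed.

Lemma measurable_uncons_rV n : measurable_fun setT (@uncons_rV n).
Proof.
apply: measurable_fun_pair; first exact: measurable_coord.
by apply: measurable_fun_rVP => i; under eq_fun do rewrite mxE;
  exact: measurable_coord.
Qed.

Section step.
Variables (n : nat) (m : {sigma_finite_measure set 'rV[R]_n -> \bar R}).

Definition lebesgue_step : set 'rV[R]_n.+1 -> \bar R :=
  pushforward (@lebesgue_measure R \x m)%E (@cons_rV n).

Let lebesgue_step0 : lebesgue_step set0 = 0%E.
Proof. by rewrite /lebesgue_step /pushforward preimage_set0 measure0. Qed.

Let lebesgue_step_ge0 A : (0 <= lebesgue_step A)%E.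
Proof. by rewrite /lebesgue_step /pushforward. Qed.

Let preimage_cons_measurable A :
  measurable A -> measurable (@cons_rV n @^-1` A).
Proof.
by move=> mA; rewrite -[X in measurable X]setTI; exact: measurable_cons_rV.
Qed.

Let lebesgue_step_sigma_additive : semi_sigma_additive lebesgue_step.
Proof.
move=> F mF tF mUF; rewrite /lebesgue_step /pushforward preimage_bigcup.
apply: measure_semi_sigma_additive.
- by move=> i; exact: preimage_cons_measurable.
- apply/trivIsetP => /= i j _ _ ij; rewrite -preimage_setI.
  by move/trivIsetP : tF => /(_ _ _ _ _ ij) ->//; rewrite preimage_set0.
- by rewrite -preimage_bigcup; exact: preimage_cons_measurable.
Qed.

HB.instance Definition _ := isMeasure.Build _ _ _ lebesgue_step
  lebesgue_step0 lebesgue_step_ge0 lebesgue_step_sigma_additive.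

Let lebesgue_step_sigma_finite : sigma_finite setT lebesgue_step.
Proof.
have /sigma_finiteP[F [FT ndF Foo]] := sigma_finiteT (@lebesgue_measure R).
have /sigma_finiteP[G [GT ndG Goo]] := sigma_finiteT m.
exists (fun i => @uncons_rV n @^-1` (F i `*` G i)).
  apply/seteqP; split=> // x _.
  have [i _ Fi] : (\bigcup_i F i) (uncons_rV x).1 by rewrite -FT.
  have [j _ Gj] : (\bigcup_i G i) (uncons_rV x).2 by rewrite -GT.
  exists (maxn i j) => //; split.
  - by move: Fi; exact/subsetPset/ndF/leq_maxl.
  - by move: Gj; exact/subsetPset/ndG/leq_maxr.
move=> i; have [mF ?] := Foo i; have [mG ?] := Goo i; split.
  rewrite -[X in measurable X]setTI; apply: measurable_uncons_rV => //.
  exact: measurableX.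
rewrite /lebesgue_step /pushforward (_ : _ @^-1` _ = F i `*` G i).
  by rewrite product_measure1E// lte_mul_pinfty// ge0_fin_numE.
by rewrite -comp_preimage (_ : _ \o _ = id)//; apply/funext/cons_rVK.
Qed.

HB.instance Definition _ := Measure_isSigmaFinite.Build _ _ _ lebesgue_step
  lebesgue_step_sigma_finite.

End step.

Fixpoint lebesgue_rV n : {sigma_finite_measure set 'rV[R]_n -> \bar R} :=
  if n is n'.+1 then lebesgue_step (lebesgue_rV n') else \d_(0 : 'rV[R]_0).

Lemma lebesgue_rV_box n (A : 'I_n -> set R) : (forall i, measurable (A i)) ->
  lebesgue_rV n [set x | forall i, A i (x ord0 i)] =
  (\prod_(i < n) lebesgue_measure (A i))%E.
Proof.
elim: n A => [|n IHn] A mA; first by rewrite big_ord0 /= diracE mem_set// => -[].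
have mB : measurable [set x : 'rV[R]_n | forall i, A (lift ord0 i) (x ord0 i)].
  rewrite (_ : [set _ | _] = \bigcap_(i in [set: 'I_n])
      ((fun x : 'rV[R]_n => x ord0 i : R) @^-1` A (lift ord0 i))); last first.
    by apply/seteqP; split=> x Ax //= i; [move=> _|]; exact: Ax.
  apply: fin_bigcap_measurable => // i _; rewrite -[X in measurable X]setTI.
  exact: measurable_coord.
rewrite big_ord_recl -IHn//= /lebesgue_step /pushforward -product_measure1E//.
  congr (_ _); apply/seteqP; split=> [[a x]/= Aax|[a x] [/= Aa Ax] i].
    split=> /= [|i]; first by have := Aax ord0; rewrite mxE unlift_none.
    by have := Aax (lift ord0 i); rewrite mxE liftK.
  by rewrite mxE; case: unliftP => [j|] -> /=.
exact: mA.
Qed.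

End lebesgue_rV.

Section euclidean.
Variables (R : realType) (n : nat).
Implicit Types x c : 'rV[R]_n.

(* The library norm on 'rV[R]_n is the sup norm; this is the Euclidean one. *)
Definition enorm x : R := Num.sqrt (\sum_i x ord0 i ^+ 2).

Definition eball c (r : R) : set 'rV[R]_n := [set x | enorm (x - c) < r].

Definition enorm_infty : set_system 'rV[R]_n :=
  filter_from setT (fun r : R => [set x | r < enorm x]).

#[global] Instance enorm_infty_filter : Filter enorm_infty.
Proof.
apply: filter_from_filter => [|r s _ _]; first by exists 0.
by exists (Num.max r s) => // x /=; rewrite gt_max => /andP[].
Qed.

End euclidean.
Arguments enorm_infty : clear implicits.

Section interaction_energy.
Variables (R : realType) (n : nat) (W : 'rV[R]_n -> \bar R).
Local Open Scope ereal_scope.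

Definition interaction_energy (rho : probability 'rV[R]_n R) : \bar R :=
  (2^-1)%:E * \int[rho \x rho]_z W (z.1 - z.2)%R.

Definition is_global_minimiser (rho : probability 'rV[R]_n R) : Prop :=
  forall mu : probability 'rV[R]_n R,
    interaction_energy rho <= interaction_energy mu.

End interaction_energy.

(* Main.v *)
Require Import Defs.
From HB Require Import structures.
From mathcomp Require Import all_boot all_order all_algebra.
From mathcomp Require Import all_classical all_reals all_analysis.
From mathcomp Require Import measurable_realfun ring lra zify.

Import Order.TTheory GRing.Theory Num.Theory.
Import numFieldNormedType.Exports.

Local Open Scope classical_set_scope.
Local Open Scope ring_scope.
Local Open Scope ereal_scope.

(** Subtracting the lower bound of W turns it into a kernel K >= 0 and shifts the
    double integral of every probability measure by the same constant
    ([interaction_energyE]).  So let F(m) be the double integral of K(x - y)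
    against m x m, and Kinf the limit of K at infinity.  The claim becomes: F has
    a minimiser iff F(rho) <= Kinf for some rho.

    A minimiser satisfies F(rho) <= Kinf ([minimiser_energy_le]).  Lebesgue
    measure on the unit cube has finite energy, because K is locally integrable
    and Lebesgue measure is translation invariant; hence F(rho) is finite.
    Truncate rho to a large cube and add a copy of it translated far along a
    coordinate axis.  The cross terms are at most Kinf, since K increases to its
    limit, so half of the old self-energy has been traded for interactions at
    level Kinf.  If Kinf < F(rho), this would beat rho.

    Conversely, suppose F(rho) <= Kinf.  If no measure has energy below Kinf,
    rho is itself a minimiser.  Otherwise F takes a value below some
    c < A < Kinf, and a minimiser is found in three steps.

    On each box [0, a]^d there is a minimiser ([exists_box_minimiser]).  This is
    weak compactness together with lower semicontinuity.  The box is cut into a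
    binary tree of cells of vanishing diameter; the masses of the cells converge
    along an ultrafilter, and the limit masses are realised by nested
    subintervals of [0, 1[.  Following the intervals that contain t gives a point
    X(t), and the law of X is the limit measure.  Lower semicontinuity of K bounds
    K(X(s) - X(t)) by the lower limit of its infima over pairs of cells, and
    Fatou's lemma concludes.

    The minimisers on boxes do not spread ([confined_translate]).  By the
    Euler-Lagrange inequality the potential of such a minimiser is less than c
    almost everywhere.  As K >= A at distance D, almost every point therefore has
    mass at least 1 - c / A within distance D.  If a coordinate slab of width D
    carried no mass between two parts of the measure, moving these parts closer
    would strictly decrease the energy, by monotonicity of K in that coordinate.
    So the occupied slabs of width D are consecutive, and their number is bounded
    independently of a: up to a translation, all these minimisers live in one box.

    The minimiser on a box that is large enough thus has the least energy among
    all compactly supported measures, and truncation extends this to all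
    measures ([energy_ge_boxes], [exists_global_minimiser]). *)

Set Implicit Arguments.
Unset Strict Implicit.

(** * Mutual energies *)

Section Energy.
Context {R : realType} {d : nat}.
Local Notation T := 'rV[R]_d.
Implicit Types (K : T -> \bar R) (m : {finite_measure set T -> \bar R}).

Lemma measurable_subr : measurable_fun setT (fun z : T * T => (z.1 - z.2)%R).
Proof.
apply: measurable_fun_rVP => i.
under eq_fun do rewrite !mxE.
apply: measurable_funB; apply: (measurableT_comp (measurable_coord i)).
  exact: measurable_fst.
exact: measurable_snd.
Qed.

Definition potential K (m : set T -> \bar R) (x : T) : \bar R :=
  \int[m]_y K (x - y)%R.

(** A bilinear form without the factor 1/2, so that the energy of a combination
    of measures can be expanded. *)
Definition energy K (m1 m2 : set T -> \bar R) : \bar R :=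
  \int[m1]_x potential K m2 x.

Section Kernel.
Variable K : T -> \bar R.
Hypothesis mK : measurable_fun setT K.
Hypothesis K0 : forall x, 0 <= K x.

Lemma measurable_kernel : measurable_fun setT (fun z : T * T => K (z.1 - z.2)%R).
Proof. exact: (measurableT_comp mK measurable_subr). Qed.

Lemma measurable_kernel_l (x : T) : measurable_fun setT (fun y : T => K (x - y)%R).
Proof.
apply: (measurableT_comp mK); apply: measurable_fun_rVP => i.
under eq_fun do rewrite !mxE.
apply: measurable_funB => //; exact: measurable_coord.
Qed.

Lemma potential_ge0 (m : {measure set T -> \bar R}) x : 0 <= potential K m x.
Proof. exact: integral_ge0. Qed.

Lemma energy_ge0 (m1 m2 : {measure set T -> \bar R}) : 0 <= energy K m1 m2.
Proof. by apply: integral_ge0 => x _; exact: potential_ge0. Qed.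

Lemma measurable_potential m : measurable_fun setT (potential K m).
Proof. exact: (measurable_fun_fubini_tonelli_F (m2 := m) _ measurable_kernel (fun=> K0 _)). Qed.

Lemma energyE m1 m2 :
  energy K m1 m2 = \int[m1 \x m2]_z K (z.1 - z.2)%R.
Proof. by rewrite (fubini_tonelli1 _ measurable_kernel). Qed.

Lemma energyC m1 m2 : (forall x, K x = K (- x)%R) ->
  energy K m1 m2 = energy K m2 m1.
Proof.
move=> Ke.
rewrite /energy /potential.
have -> := fubini_tonelli _ measurable_kernel (fun=> K0 _) (m1 := m1) (m2 := m2).
apply: eq_integral => x _; apply: eq_integral => y _.
by rewrite Ke opprB.
Qed.

End Kernel.

Lemma integral_mrestr (dd : measure_display) (X : measurableType dd)
    (m : {measure set X -> \bar R}) (D : set X) (mD : measurable D)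
    (f : X -> \bar R) :
  measurable_fun setT f -> (forall x, 0 <= f x) ->
  \int[mrestr m mD]_x f x = \int[m]_(x in D) f x.
Proof.
move=> mf f0.
have -> : \int[mrestr m mD]_x f x = \int[mrestr m mD]_(x in D) f x.
  rewrite (@ge0_negligible_integral _ _ _ (mrestr m mD) setT (~` D))//.
  - by rewrite setTD setCK.
  - exact: measurableC.
  - by rewrite /= /mrestr setICl measure0.
by apply: eq_measure_integral => A mA AD; rewrite /= /mrestr setIidl.
Qed.

End Energy.

Section FiniteSum.
Context {dd : measure_display} {X : measurableType dd} {R : realType}.
Variables m1 m2 : {finite_measure set X -> \bar R}.

Let fin_num_measure_add : fin_num_fun (measure_add m1 m2).
Proof. by move=> A mA; rewrite measure_addE fin_numD !fin_num_measure. Qed.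

HB.instance Definition _ := Measure.copy (measure_add m1 m2)
  (msum (fun n => if n is 0%N then m1 : {measure set X -> \bar R} else m2) 2).
HB.instance Definition _ :=
  @Measure_isFinite.Build _ X _ (measure_add m1 m2) fin_num_measure_add.
End FiniteSum.

Section Bilinear.
Context {R : realType} {d : nat}.
Local Notation T := 'rV[R]_d.
Variable K : T -> \bar R.
Hypothesis mK : measurable_fun setT K.
Hypothesis K0 : forall x, 0 <= K x.
Implicit Types m : {finite_measure set T -> \bar R}.

Lemma energy_addl m1 m2 m :
  energy K (measure_add m1 m2) m = energy K m1 m + energy K m2 m.
Proof.
apply: ge0_integral_measure_add => //; first by move=> x _; exact: potential_ge0.
exact: measurable_potential.
Qed.

Lemma energy_addr m m1 m2 :
  energy K m (measure_add m1 m2) = energy K m m1 + energy K m m2.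
Proof.
rewrite /energy -ge0_integralD//; first last.
- exact: measurable_potential.
- by move=> x _; exact: potential_ge0.
- exact: measurable_potential.
- by move=> x _; exact: potential_ge0.
apply: eq_integral => x _.
by apply: ge0_integral_measure_add => //; exact: measurable_kernel_l.
Qed.

Lemma energy_scalel (c : {nonneg R}) m1 m2 :
  energy K (mscale c m1) m2 = c%:num%:E * energy K m1 m2.
Proof.
apply: ge0_integral_mscale => //; first exact: measurable_potential.
by move=> x _; exact: potential_ge0.
Qed.

Lemma energy_scaler (c : {nonneg R}) m1 m2 :
  energy K m1 (mscale c m2) = c%:num%:E * energy K m1 m2.
Proof.
rewrite /energy -ge0_integralZl//; first last.
- by move=> x _; exact: potential_ge0.
- exact: measurable_potential.
apply: eq_integral => x _; apply: ge0_integral_mscale => //.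
exact: measurable_kernel_l.
Qed.

Lemma energy_restrl m1 m2 (A : set T) (mA : measurable A) :
  energy K (mrestr m1 mA) m2 = \int[m1]_(x in A) potential K m2 x.
Proof.
apply: integral_mrestr; first exact: measurable_potential.
by move=> x; exact: potential_ge0.
Qed.

Lemma potential_restr m (A : set T) (mA : measurable A) x :
  potential K (mrestr m mA) x = \int[m]_(y in A) K (x - y)%R.
Proof. by apply: integral_mrestr => //; exact: measurable_kernel_l. Qed.

Lemma le_energy_restrl m1 m2 (A : set T) (mA : measurable A) :
  energy K (mrestr m1 mA) m2 <= energy K m1 m2.
Proof.
rewrite energy_restrl; apply: ge0_subset_integral => //.
  exact: measurable_potential.
by move=> x _; exact: potential_ge0.
Qed.

Lemma le_energy_restrr m1 m2 (A : set T) (mA : measurable A) :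
  energy K m1 (mrestr m2 mA) <= energy K m1 m2.
Proof.
apply: ge0_le_integral => //.
- by move=> x _; exact: potential_ge0.
- exact: measurable_potential.
- exact: measurable_potential.
move=> x _; rewrite potential_restr; apply: ge0_subset_integral => //.
exact: measurable_kernel_l.
Qed.

Lemma le_energy_restr m (A : set T) (mA : measurable A) :
  energy K (mrestr m mA) (mrestr m mA) <= energy K m m.
Proof. exact: le_trans (le_energy_restrl _ _ _) (le_energy_restrr _ _ _). Qed.

(** Normalising a finite measure turns minimality among probability measures into
    a bound homogeneous of degree two, so competitors need no normalisation. *)
Lemma energy_homogeneous_bound (Q : set T) (f : R) :
  (forall nu : probability T R, nu (~` Q) = 0 -> f%:E <= energy K nu nu) ->
  forall m, m (~` Q) = 0 -> f%:E * (m setT * m setT) <= energy K m m.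
Proof.
move=> fmin m mQ.
have mfin : m setT \is a fin_num by rewrite fin_num_measure.
have [m0|m0] := eqVneq (m setT) 0; first by rewrite m0 !mule0 energy_ge0.
set c := fine (m setT).
have cE : m setT = c%:E by rewrite fineK.
have c0 : (0 < c)%R.
  by rewrite -lte_fin -cE lt0e m0 measure_ge0.
have ci0 : (0 <= c^-1)%R by rewrite invr_ge0 ltW.
pose nu : probability T R := mnormalize m (dirac (0%R : T)).
have nuE : (nu : set T -> \bar R) = mscale (NngNum ci0) m.
  apply/funext => A; rewrite /nu /= /mnormalize /mscale (negbTE m0) /=.
  by rewrite cE /= muleC.
have nuQ : nu (~` Q) = 0 by rewrite nuE /mscale [X in _ * X]mQ mule0.
have := fmin nu nuQ; rewrite nuE.
rewrite energy_scalel energy_scaler /= cE -!EFinM => h.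
move: h (energy_ge0 K0 m m); case: (energy K m m) => [r h r0|_ _|//]; last exact: leey.
rewrite -!EFinM !lee_fin in h *.
by move: h; rewrite mulrA -invfM mulrC ler_pdivlMr ?mulr_gt0.
Qed.

End Bilinear.

(** * The Euler-Lagrange inequality *)

Section EulerLagrange.
Context {R : realType} {d : nat}.
Local Notation T := 'rV[R]_d.
Variable K : T -> \bar R.
Hypothesis mK : measurable_fun setT K.
Hypothesis K0 : forall x, 0 <= K x.
Hypothesis Ke : forall x, K x = K (- x)%R.
Variables (Q : set T) (mu : probability T R) (f : R).
Hypothesis mQ : measurable Q.
Hypothesis muQ : mu (~` Q) = 0.
Hypothesis muf : energy K mu mu = f%:E.
Hypothesis fmin : forall nu : probability T R,
  nu (~` Q) = 0 -> f%:E <= energy K nu nu.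

(** The inequality at order one in t: compare derivatives at t = 0. *)
Lemma first_variation (a v q : R) :
  (forall t, 0 < t -> f * (1 + t * a) ^+ 2 <= f + 2 * t * v + t ^+ 2 * q)%R ->
  (f * a <= v)%R.
Proof.
move=> h; rewrite leNgt; apply/negP => va.
have d0 : (0 < f * a - v)%R by rewrite subr_gt0.
set del := (f * a - v)%R in d0.
(* The difference of the two sides is t (2 del - t g), which is positive as soon
   as t g < del. *)
set g := (q - f * a ^+ 2)%R.
have g1 : (0 < `|g| + 1)%R by rewrite ltr_wpDl.
have t0 : (0 < del / (`|g| + 1))%R by rewrite divr_gt0.
have := h _ t0; set t := (del / _)%R in t0 *.
have tg : (t * g < del)%R.
  rewrite (@le_lt_trans _ _ (t * `|g|)%R)//; first by rewrite ler_pM2l// ler_norm.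
  by rewrite /t mulrAC ltr_pdivrMr// ltr_pM2l// ltrDl.
apply/negP; rewrite -ltNge.
rewrite -subr_gt0.
have -> : (f * (1 + t * a) ^+ 2 - (f + 2 * t * v + t ^+ 2 * q) =
  t * (2 * del - t * g))%R by rewrite /del /g; ring.
by rewrite mulr_gt0// subr_gt0 (lt_trans tg)// ltr_pMl// ltr1n.
Qed.

(** The competitor mu + t mu|_A has energy f + 2 t v + t^2 q, where v is the integral
    of the potential over A, and mass 1 + t mu(A). *)
Lemma minimiser_potential_lower (A : set T) : measurable A ->
  f%:E * mu A <= \int[mu]_(x in A) potential K mu x.
Proof.
move=> mA; pose mr : {finite_measure set T -> \bar R} := mrestr mu mA.
have mrmu : \int[mu]_(x in A) potential K mu x = energy K mr mu.
  by rewrite energy_restrl.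
have vf : energy K mr mu <= f%:E by rewrite -muf; exact: le_energy_restrl.
have qf : energy K mr mr <= f%:E by rewrite -muf; exact: le_energy_restr.
have [v vE] : exists v, energy K mr mu = v%:E.
  exists (fine (energy K mr mu)); rewrite fineK// ge0_fin_numE ?energy_ge0//.
  exact: le_lt_trans vf (ltry _).
have [q qE] : exists q, energy K mr mr = q%:E.
  exists (fine (energy K mr mr)); rewrite fineK// ge0_fin_numE ?energy_ge0//.
  exact: le_lt_trans qf (ltry _).
have [a aE] : exists a, mu A = a%:E.
  by exists (fine (mu A)); rewrite fineK// fin_num_measure.
rewrite mrmu vE aE -EFinM lee_fin; apply: (@first_variation a v q) => t t0.
pose tn : {nonneg R} := NngNum (ltW t0).
pose mm : {finite_measure set T -> \bar R} := measure_add mu (mscale tn mr).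
have mmE B : mm B = mu B + t%:E * mu (B `&` A) by exact: measure_addE.
have mmQ : mm (~` Q) = 0.
  rewrite mmE muQ (_ : mu _ = 0) ?mule0 ?adde0//.
  apply/eqP; rewrite eq_le measure_ge0 andbT -muQ.
  by rewrite le_measure// inE//; [apply: measurableI => //|]; exact: measurableC.
have := energy_homogeneous_bound mK K0 fmin mmQ.
rewrite mmE setTI probability_setT aE.
have -> : energy K mm mm = energy K mu mu + t%:E * energy K mu mr +
    (t%:E * energy K mr mu + t%:E * (t%:E * energy K mr mr)).
  rewrite [LHS](energy_addl mK K0 mu (mscale tn mr)).
  by rewrite !(energy_addr mK K0 _ mu (mscale tn mr)) !energy_scalel// !energy_scaler.
rewrite (energyC mK K0 mu mr Ke) vE qE muf -!(EFinM, EFinD) lee_fin -expr2 => /le_trans; apply.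
by rewrite le_eqVlt; apply/orP; left; apply/eqP; ring.
Qed.

(** The average of the potential is f.  Off the set B where it is at least c its
    integral is at least f mu(~B) by the previous lemma, so the excess c - f on B
    cannot be compensated. *)
Lemma minimiser_potential_upper (c : R) : (f < c)%R ->
  mu [set x | c%:E <= potential K mu x] = 0.
Proof.
move=> fc; set B := [set x | _].
have mp : measurable_fun setT (potential K mu) by exact: measurable_potential.
have mB : measurable B.
  by rewrite /B -[X in measurable X]setTI; exact: emeasurable_fun_c_infty.
have B1 : c%:E * mu B <= \int[mu]_(x in B) potential K mu x.
  rewrite -integral_cst//; apply: ge0_le_integral => //.
  - move=> x Bx; rewrite lee_fin (le_trans _ (ltW fc))//.
    by rewrite -lee_fin -muf energy_ge0.
  - exact: measurable_funTS.
have B2 := minimiser_potential_lower (measurableC mB).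
have tot : \int[mu]_(x in B) potential K mu x +
    \int[mu]_(x in ~` B) potential K mu x = f%:E.
  rewrite -muf /energy -ge0_integral_setU ?setUv//.
  - exact: measurableC.
  - by move=> x _; exact: potential_ge0.
  - by apply/disj_setPS => x [].
have := leeD B1 B2; rewrite tot probability_setC//.
have [b bE] : exists b, mu B = b%:E.
  by exists (fine (mu B)); rewrite fineK// fin_num_measure.
rewrite bE -EFinB -!EFinM -EFinD lee_fin => h.
have b0 : (0 <= b)%R by rewrite -lee_fin -bE measure_ge0.
congr EFin; apply/eqP; rewrite eq_le b0 andbT.
rewrite -(@pmulr_rle0 _ (c - f)%R) ?subr_gt0//.
by move: h; rewrite -subr_le0; congr (_ <= _)%R; ring.
Qed.

End EulerLagrange.

(** * Nested intervals realising a mass distribution on the binary tree *)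

(** The words are read from the right: b :: w is a child of w.  The function p
    distributes a unit mass over the tree, and the slots are intervals of length
    p(w) nested like the words, the true child lying to the left. *)
Section Tree.
Context {R : realType}.
Variable p : seq bool -> R.
Hypothesis p_ge0 : forall w, (0 <= p w)%R.
Hypothesis p_nil : p [::] = 1%R.
Hypothesis p_split : forall w, p w = (p (true :: w) + p (false :: w))%R.

Fixpoint slot_start (w : seq bool) : R :=
  if w is b :: w' then
    if b then slot_start w' else (slot_start w' + p (true :: w'))%R
  else 0%R.

Definition slot (w : seq bool) : set R :=
  `[slot_start w, (slot_start w + p w)%R[%classic.

(** The word of length k whose slot contains t. *)
Fixpoint branch (t : R) (k : nat) : seq bool :=
  if k is k'.+1 then
    (t < slot_start (branch t k') + p (true :: branch t k'))%R :: branch t k'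
  else [::].

Lemma size_branch t k : size (branch t k) = k.
Proof. by elim: k => //= k ->. Qed.

Lemma slot_branch t k : (0 <= t < 1)%R -> slot (branch t k) t.
Proof.
move=> t01; elim: k => [|k IH]; rewrite /slot /= in_itv/= ?p_nil ?add0r//.
move: IH; rewrite /slot /= in_itv/= => /andP[s1 s2].
case: ltP => h; first by rewrite s1.
by rewrite h/= -addrA -p_split.
Qed.

Lemma branch_uniq w t : slot w t -> (0 <= t < 1)%R /\ branch t (size w) = w.
Proof.
elim: w => [|b w IH]; first by rewrite /slot /= in_itv/= p_nil add0r.
rewrite /slot /= in_itv/= => bw.
have wt : slot w t.
  rewrite /slot /= in_itv/= p_split; case: b bw => /andP[a1 a2].
    by rewrite a1 (lt_le_trans a2)// lerD2l lerDl.
  by rewrite addrA a2 andbT (le_trans _ a1)// lerDl.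
have [t01 e] := IH wt; split => //.
by rewrite e; case: b bw => /andP[a1 a2]; [rewrite a2|rewrite ltNge a1].
Qed.

Lemma branch_suffix t j k : (j <= k)%N -> exists v, branch t k = v ++ branch t j.
Proof.
move=> /subnK <-; elim: (k - j)%N => [|n [v IH]]; first by exists [::].
rewrite addSn /=; set b := (X in X :: _); exists (b :: v).
by rewrite IH.
Qed.

Lemma lebesgue_slot w : lebesgue_measure (slot w) = (p w)%:E.
Proof.
rewrite /slot lebesgue_measure_itv/= lte_fin ltrDl.
case: ltP => [_|]; first by rewrite -EFinB addrAC subrr add0r.
by move=> pw; congr EFin; apply/eqP; rewrite eq_le p_ge0.
Qed.

Lemma measurable_slot w : measurable (slot w).
Proof. exact: measurable_itv. Qed.

End Tree.

(** * Cells cut out by a sequence of sets *)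

Section Cells.
Context {T : Type}.
Variables (Q : set T) (B : nat -> set T).

(** The letter put in front of w' tells on which side of B (size w') the cell lies. *)
Fixpoint cell (w : seq bool) : set T :=
  if w is b :: w' then cell w' `&` (if b then B (size w') else ~` B (size w'))
  else Q.

Lemma cell_cat v w : cell (v ++ w) `<=` cell w.
Proof. by elim: v => //= b v IH x [/IH]. Qed.

Lemma cell_sub w : cell w `<=` Q.
Proof. by elim: w => //= b w IH x [/IH]. Qed.

Lemma cell_same_side w n x y : (n < size w)%N -> cell w x -> cell w y ->
  B n x -> B n y.
Proof.
elim: w => //= b w IH; rewrite ltnS leq_eqVlt => /orP[/eqP->|nw].
  by case: b => -[_ bx] [_ by']//.
by move=> [xw _] [yw _]; exact: IH.
Qed.

Lemma cell_disjoint w w' : size w = size w' -> w != w' -> cell w `&` cell w' = set0.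
Proof.
elim: w w' => [|b w IH] [|b' w']//= [sw] ne.
rewrite -subset0 => x [[xw xb] [xw' xb']].
have [e|ww'] := eqVneq w w'; last by rewrite -(IH w' sw ww').
have bb : b != b' by apply: contra ne => /eqP ->; rewrite e.
by move: xb xb' bb; rewrite sw; case: b {ne}; case: b'.
Qed.

End Cells.

Lemma measurable_cell (dd : measure_display) (T : measurableType dd)
    (Q : set T) (B : nat -> set T) : measurable Q ->
  (forall n, measurable (B n)) -> forall w, measurable (cell Q B w).
Proof.
move=> mQ mB; elim=> //= b w IH; apply: measurableI => //.
by case: b => //; exact: measurableC.
Qed.

Lemma cell_split (dd : measure_display) (T : measurableType dd) (R : realType)
    (Q : set T) (B : nat -> set T) (mu : probability T R) : measurable Q ->
  (forall n, measurable (B n)) -> forall w,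
  mu (cell Q B w) = mu (cell Q B (true :: w)) + mu (cell Q B (false :: w)).
Proof.
move=> mQ mB w; rewrite -measureU/=.
- by rewrite -setIUr setUv setIT.
- by apply: measurableI => //; exact: measurable_cell.
- by apply: measurableI; [exact: measurable_cell|exact: measurableC].
- by rewrite setIACA setICr setI0.
Qed.

(** Limits along an ultrafilter replace the extraction of a subsequence that works
    for all cells at once. *)
Lemma ultra_cvg (R : realType) (U : set_system nat) (u : nat -> R) :
  UltraFilter U -> (forall n, (0 <= u n <= 1)%R) -> exists l : R, u @ U --> l.
Proof.
move=> UU u01.
have PU : ProperFilter (u @ U) by exact: fmap_proper_filter.
have : (u @ U) `[0%R, 1%R]%classic.
  by apply: (@filterS _ U _ setT) => [n _ /=|]; [rewrite in_itv/=|exact: filterT].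
move=> /(@segment_compact R 0 1)%R => -[l [_ cl]].
exists l => A Al /=; have [//|nA] := in_ultra_setVsetC (u @^-1` A) UU.
by have [x []] := cl (~` A) A nA Al.
Qed.
Section Box.
Context {R : realType} {d : nat}.
Local Notation T := 'rV[R]_d.

Definition box (a : R) : set T := [set x | forall i, (0 <= x ord0 i <= a)%R].

Lemma measurable_coord_set (i : 'I_d) (A : set R) : measurable A ->
  measurable [set x : T | A (x ord0 i)].
Proof.
by move=> mA; have := measurable_coord i measurableT mA; rewrite setTI.
Qed.

Lemma measurable_coord_lt (i : 'I_d) (t : R) :
  measurable [set x : T | (x ord0 i < t)%R].
Proof.
have := @measurable_coord_set i `]-oo, t[%classic (measurable_itv _).
by congr measurable; apply/seteqP; split => x /=; rewrite in_itv.
Qed.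

Lemma measurable_coord_ge (i : 'I_d) (t : R) :
  measurable [set x : T | (t <= x ord0 i)%R].
Proof.
have := @measurable_coord_set i `[t, +oo[%classic (measurable_itv _).
by congr measurable; apply/seteqP; split => x /=; rewrite in_itv/= andbT.
Qed.

Lemma measurable_forall_coord (A : 'I_d -> set R) : (forall i, measurable (A i)) ->
  measurable [set x : T | forall i, A i (x ord0 i)].
Proof.
move=> mA; rewrite (_ : [set _ | _] = \bigcap_(i in [set: 'I_d])
    [set x : T | A i (x ord0 i)]); last first.
  by apply/seteqP; split=> x Ax //= i; [move=> _|]; exact: Ax.
by apply: fin_bigcap_measurable => // i _; exact: measurable_coord_set.
Qed.

Lemma measurable_box a : measurable (box a).
Proof.
have -> : box a = [set x : T | forall i, (`[0%R, a]%classic : set R) (x ord0 i)].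
  by apply/seteqP; split => x /= + i => /(_ i); rewrite in_itv/=.
by apply: (@measurable_forall_coord (fun=> `[0%R, a]%classic)) => i; exact: measurable_itv.
Qed.

(** An enumeration of all half-spaces x_i < q with q rational; their sides separate
    the points of a box, uniformly by [small_cells]. *)
Definition rat_halfspace (n : nat) : set T :=
  if @unpickle ('I_d * rat)%type n is Some iq
  then [set x : T | (x ord0 iq.1 < ratr iq.2)%R] else set0.

Lemma measurable_rat_halfspace n : measurable (rat_halfspace n).
Proof.
rewrite /rat_halfspace; case: unpickle => [[i q]|//] /=.
exact: measurable_coord_lt.
Qed.

(** Two points of the box that differ by more than e in some coordinate are
    separated by a point of the grid of step 1/(m+1) < e.  Only finitely many
    grid points lie in [0, a], and k0 exceeds all of their indices. *)
Lemma small_cells (a e : R) : (0 < e)%R -> exists k0, forall w, (k0 <= size w)%N ->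
  forall x y, cell (box a) rat_halfspace w x -> cell (box a) rat_halfspace w y ->
  forall i, (`|x ord0 i - y ord0 i| <= e)%R.
Proof.
move=> e0.
pose m := Num.truncn (e^-1).
have me : (m.+1%:R^-1 < e)%R.
  rewrite invf_plt ?posrE//.
  by have := truncn_itv (ltW (_ : 0 < e^-1)%R); rewrite invr_gt0 => /(_ e0) /andP[].
pose L := Num.truncn (a * m.+1%:R).
pose q (l : nat) : rat := (l%:R / m.+1%:R)%R.
have qE l : ratr (q l) = (l%:R / m.+1%:R)%R :> R.
  by rewrite /q fmorph_div !rmorph_nat.
pose k0 := (\max_(z : 'I_d * 'I_L.+1) pickle (z.1, q z.2)).+1.
exists k0 => w kw.
have key x y i : cell (box a) rat_halfspace w x -> cell (box a) rat_halfspace w y ->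
    (y ord0 i - x ord0 i <= e)%R.
  move=> wx wy; rewrite leNgt; apply/negP => xy.
  have /andP[x0 xa] := cell_sub wx i.
  have /andP[y0 ya] := cell_sub wy i.
  pose l := Num.truncn (y ord0 i * m.+1%:R).
  have /andP[l1 l2] : (l%:R <= y ord0 i * m.+1%:R < l.+1%:R)%R.
    by apply: truncn_itv; rewrite mulr_ge0.
  have lL : (l < L.+1)%N by rewrite ltnS le_truncn// ler_wpM2r.
  pose n := pickle (i, q l).
  have nw : (n < size w)%N.
    apply: leq_trans kw; rewrite /k0 ltnS.
    by rewrite (@leq_bigmax _ (fun z : 'I_d * 'I_L.+1 => pickle (z.1, q z.2)) (i, Ordinal lL)).
  have := cell_same_side nw wx wy.
  rewrite /rat_halfspace /n pickleK /= qE => xyn.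
  have : (x ord0 i < l%:R / m.+1%:R)%R.
    rewrite ltr_pdivlMr ?ltr0n// -(ltrD2r 1) natr1 (le_lt_trans _ l2)//.
    rewrite -[leLHS](_ : (x ord0 i + m.+1%:R^-1) * m.+1%:R = _)%R; last first.
      by rewrite mulrDl mulVf// pnatr_eq0.
    by rewrite ler_pM2r ?ltr0n// ltW// -ltrBrDl (lt_trans me).
  move=> /xyn; rewrite ltr_pdivlMr ?ltr0n// ltNge.
  by rewrite l1.
by move=> x y wx wy i; rewrite ler_norml (key _ _ _ wy wx) andbT lerNl opprB key.
Qed.

End Box.
(** * Lower bounds of integrals by finite sums *)

Section FiniteFamily.
Context {dd : measure_display} {X : measurableType dd} {R : realType}.
Variables (m : {measure set X -> \bar R}) (I : finType) (F : I -> set X).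
Hypothesis mF : forall i, measurable (F i).
Hypothesis tF : forall i j, i != j -> F i `&` F j = set0.

Lemma sum_le_integral (h : I -> R) (f : X -> \bar R) :
  measurable_fun setT f -> (forall x, 0 <= f x) -> (forall i, 0 <= h i)%R ->
  (forall i x, F i x -> (h i)%:E <= f x) ->
  \sum_(i : I) (h i)%:E * m (F i) <= \int[m]_x f x.
Proof.
move=> mf f0 h0 hf.
have -> : \sum_(i : I) (h i)%:E * m (F i) = \sum_(i : I) \int[m]_(x in F i) (h i)%:E.
  by apply: eq_bigr => i _; rewrite integral_cst.
apply: (@le_trans _ _ (\sum_(i : I) \int[m]_(x in F i) f x)).
  apply: lee_sum => i _; apply: ge0_le_integral => //.
  - by move=> x _; rewrite lee_fin.
  - exact: measurable_funTS.
  - by move=> x; exact: hf.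
rewrite -(@ge0_integral_bigsetU _ _ _ _ I F f (index_enum I))//.
- apply: ge0_subset_integral => //.
  by apply: bigsetU_measurable => i _.
- exact: index_enum_uniq.
- by apply/trivIsetP => i j _ _; exact: tF.
- exact: measurable_funTS.
Qed.

End FiniteFamily.

Section Liminf.
Context {R : realType}.
Implicit Types (u : (\bar R)^nat) (b : \bar R).

Lemma limn_einf_ge u b N : (forall n, (N <= n)%N -> b <= u n) -> b <= limn_einf u.
Proof.
move=> h; rewrite limn_einf_lim (cvg_lim _ (@cvg_einfs_sup _ u))//.
apply: (@le_trans _ _ (einfs u N)); last by apply: ereal_sup_ubound; exists N.
by apply: le_ereal_inf_tmp => _ [n /= Nn <-]; exact: h.
Qed.

Lemma limn_einf_le u b : (forall n, u n <= b) -> limn_einf u <= b.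
Proof.
move=> h; rewrite limn_einf_lim (cvg_lim _ (@cvg_einfs_sup _ u))//.
apply: ge_ereal_sup => _ [n _ <-].
by apply: le_trans (h n); apply: ereal_inf_lbound; exists n => /=.
Qed.

Lemma cvg_bigsum (F : set_system nat) (I : Type) (s : seq I) (f : I -> nat -> R)
    (l : I -> R) : Filter F -> (forall i, f i @ F --> l i) ->
  (fun n => \sum_(i <- s) f i n)%R @ F --> (\sum_(i <- s) l i)%R.
Proof.
move=> FF fl; elim: s => [|i s IH].
  by rewrite big_nil; under eq_fun do rewrite big_nil; exact: cvg_cst.
by rewrite big_cons; under eq_fun do rewrite big_cons; exact: cvgD.
Qed.

End Liminf.

Section WeakLimit.
Context {R : realType} {d : nat}.
Local Notation T := 'rV[R]_d.
Variable K : T -> \bar R.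
Hypothesis mK : measurable_fun setT K.
Hypothesis K0 : forall x, 0 <= K x.
Hypothesis Klsc : lower_semicontinuous K.
Variable a : R.

Local Notation cl := (cell (box a) rat_halfspace).

(** The infimum of K over the differences of two cells, truncated at k so that
    it is a real number even when the infimum is infinite. *)
Definition cell_inf (k : nat) (w w' : seq bool) : R :=
  fine (mine k%:R%:E (ereal_inf [set K (z.1 - z.2)%R | z in cl w `*` cl w'])).

Lemma cell_infE k w w' : (cell_inf k w w')%:E =
  mine k%:R%:E (ereal_inf [set K (z.1 - z.2)%R | z in cl w `*` cl w']).
Proof.
have i0 : 0 <= ereal_inf [set K (z.1 - z.2)%R | z in cl w `*` cl w'].
  by apply: le_ereal_inf_tmp => _ [z _ <-].
rewrite /cell_inf fineK// ge0_fin_numE ?le_min ?i0 ?lee_fin ?ler0n//.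
by rewrite gt_min ltry.
Qed.

Lemma cell_inf_ge0 k w w' : (0 <= cell_inf k w w')%R.
Proof.
rewrite -lee_fin cell_infE le_min lee_fin ler0n/=.
by apply: le_ereal_inf_tmp => _ [z _ <-].
Qed.

Lemma cell_inf_le k w w' x y : cl w x -> cl w' y ->
  (cell_inf k w w')%:E <= K (x - y)%R.
Proof.
move=> wx wy; rewrite cell_infE ge_min; apply/orP; right.
by apply: ereal_inf_lbound; exists (x, y).
Qed.

Local Notation pairs k := (k.-tuple bool * k.-tuple bool)%type.

(** Discretising the energy on cells decreases it; the discrete energy is a
    polynomial in the cell masses, hence continuous in them. *)
Lemma cell_energy_le (m : probability T R) k :
  \sum_(z : pairs k) (cell_inf k z.1 z.2)%:E * (m (cl z.1) * m (cl z.2)) <=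
  energy K m m.
Proof.
rewrite (energyE mK K0).
have mcl := measurable_cell (measurable_box a) (@measurable_rat_halfspace R d).
under eq_bigr do rewrite -product_measure1E//.
apply: (@sum_le_integral _ _ _ (m \x m) _
  (fun z : pairs k => cl z.1 `*` cl z.2) _ _ (fun z => cell_inf k z.1 z.2)).
- by move=> z; exact: measurableX.
- move=> [w1 w2] [v1 v2] /= ne; rewrite -setXI.
  have [e1|n1] := eqVneq (w1 : seq bool) v1.
    rewrite [X in _ `*` X]cell_disjoint ?setX0// ?size_tuple//.
    by apply: contra ne => /eqP e2; apply/eqP; congr pair; exact: val_inj.
  by rewrite cell_disjoint ?set0X// !size_tuple.
- exact: measurable_kernel.
- by move=> z.
- by move=> z; exact: cell_inf_ge0.
- by move=> z [x y] [/= zx zy]; exact: cell_inf_le.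
Qed.

End WeakLimit.
Lemma le_by_reals {R : realType} (x y : \bar R) :
  (forall b : R, b%:E < x -> b%:E <= y) -> x <= y.
Proof.
move=> h; rewrite leNgt; apply/negP => yx.
case: y x h yx => [r| |] [s| |]//= h yx.
- have rs : (r < s)%R by rewrite -lte_fin.
  have := h ((r + s) / 2)%R; rewrite lte_fin lee_fin => /(_ (midf_lt rs).2).
  by rewrite leNgt (midf_lt rs).1.
- by have := h (r + 1)%R (ltry _); rewrite lee_fin leNgt ltrDl ltr01.
- by have := h (s - 1)%R; rewrite lte_fin gtrBl ltr01 => /(_ erefl).
- by have := h 0%R (ltry _).
Qed.

(** * The limit measure as a law on the unit interval *)

Section UnitInterval.
Variable R : realType.

Definition unit_measure : set (measurableTypeR R) -> \bar R :=
  mrestr (@lebesgue_measure R) (measurable_itv `[0%R, 1%R[).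

HB.instance Definition _ := Measure.copy unit_measure
  (mrestr (@lebesgue_measure R) (measurable_itv `[0%R, 1%R[)).

Let unit_measure_setT : unit_measure setT = 1.
Proof.
rewrite /unit_measure /mrestr setTI lebesgue_measure_itv/= lte_fin ltr01.
by rewrite oppr0 adde0.
Qed.

HB.instance Definition _ :=
  Measure_isProbability.Build _ _ _ unit_measure unit_measure_setT.

Lemma unit_measureE A : A `<=` `[0%R, 1%R[%classic ->
  unit_measure A = lebesgue_measure A.
Proof. by move=> A01; rewrite /unit_measure /mrestr setIidl. Qed.

Lemma unit_measure_out A : A `&` `[0%R, 1%R[%classic = set0 -> unit_measure A = 0.
Proof. by rewrite /unit_measure /mrestr => ->; rewrite measure0. Qed.

End UnitInterval.

Lemma energy_distribution {R : realType} {d : nat} (K : 'rV[R]_d -> \bar R)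
    (mK : measurable_fun setT K) (K0 : forall x, 0 <= K x)
    (dd : measure_display) (Om : measurableType dd) (P : probability Om R)
    (X : {mfun Om >-> 'rV[R]_d}) :
  energy K (distribution P X) (distribution P X) =
  \int[P]_s \int[P]_t K (X s - X t)%R.
Proof.
rewrite /energy ge0_integral_distribution//; first last.
- by move=> x; exact: potential_ge0.
- exact: measurable_potential.
apply: eq_integral => s _.
by rewrite /= /potential ge0_integral_distribution//; exact: measurable_kernel_l.
Qed.

Section Realisation.
Context {R : realType} {d : nat}.
Local Notation T := 'rV[R]_d.
Variable K : T -> \bar R.
Hypothesis mK : measurable_fun setT K.
Hypothesis K0 : forall x, 0 <= K x.
Hypothesis Klsc : lower_semicontinuous K.
Variable a : R.
Local Notation cl := (cell (box a) (@rat_halfspace R d)).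
Local Notation pairs k := (k.-tuple bool * k.-tuple bool)%type.

Variable p : seq bool -> R.
Hypothesis p_ge0 : forall w, (0 <= p w)%R.
Hypothesis p_nil : p [::] = 1%R.
Hypothesis p_split : forall w, p w = (p (true :: w) + p (false :: w))%R.
Hypothesis p_cell : forall w, (0 < p w)%R -> cl w !=set0.

Local Notation br := (branch p).
Local Notation sl := (slot p).

(* Cells of positive mass are nonempty, and only these occur along branches; the
   default 0 is never reached there. *)
Let pt (w : seq bool) : T := xget 0%R (cl w).

Let ptP t k : (0 <= t < 1)%R -> cl (br t k) (pt (br t k)).
Proof.
move=> t01; apply: (xgetPex 0%R); apply: p_cell.
have := slot_branch p_nil p_split k t01; rewrite /slot /= in_itv/=.
by move=> /andP[h1 /(le_lt_trans h1)]; rewrite ltrDl.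
Qed.

Let sl_uniq t k (w : k.-tuple bool) : (0 <= t < 1)%R ->
  sl w t = (w = br t k :> seq bool) :> Prop.
Proof.
move=> t01; apply/propext; split; last by move=> ->; exact: slot_branch.
by move=> /(branch_uniq p_ge0 p_nil p_split) [_]; rewrite size_tuple.
Qed.

Let brt t k : k.-tuple bool := tcast (size_branch p t k) (in_tuple (br t k)).

Let brtE t k : brt t k = br t k :> seq bool.
Proof. by rewrite val_tcast. Qed.

(** Written as a finite sum of indicators to make its measurability evident; on
    [0, 1[ it is the i-th coordinate of a point of the cell of the k-th branch of t. *)
Definition branch_point (i : 'I_d) k (t : measurableTypeR R) : R :=
  (\sum_(w : k.-tuple bool) pt w ord0 i * \1_(sl w) t)%R.

Let branch_pointE i k t : (0 <= t < 1)%R -> branch_point i k t = pt (br t k) ord0 i.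
Proof.
move=> t01; rewrite /branch_point (bigD1 (brt t k))//= indicE mem_set ?sl_uniq ?brtE//.
rewrite mulr1 big1 ?addr0// => w ne; rewrite indicE memNset ?mulr0//.
by rewrite sl_uniq// -brtE => /val_inj e; rewrite e eqxx in ne.
Qed.

Let branch_point_out i k t : ~ (0 <= t < 1)%R -> branch_point i k t = 0%R.
Proof.
move=> t01; rewrite /branch_point big1// => w _; rewrite indicE memNset ?mulr0//.
by move=> /(branch_uniq p_ge0 p_nil p_split)[].
Qed.

Let measurable_branch_point i k : measurable_fun setT (branch_point i k).
Proof.
apply: measurable_sum => w; apply: measurable_funM => //.
by apply: measurable_indic; apply: measurable_slot.
Qed.

Definition limit_map (t : measurableTypeR R) : T := \row_i limn (fun k => branch_point i k t).

Let branch_cell t j k : (0 <= t < 1)%R -> (j <= k)%N -> cl (br t j) (pt (br t k)).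
Proof.
move=> t01 jk; have [v e] := branch_suffix p t jk.
by apply: (@cell_cat _ _ _ v); rewrite -e; exact: ptP.
Qed.

Let cvg_branch_point i t : cvgn (fun k => branch_point i k t).
Proof.
have [t01|t01] := pselect (0 <= t < 1)%R; last first.
  by under eq_fun do rewrite branch_point_out//; exact: is_cvg_cst.
apply/cauchy_cvgP/cauchy_exP => e e0.
have [k0 hk] := @small_cells R d a (e / 2) (divr_gt0 e0 (ltr0Sn _ _)).
exists (pt (br t k0) ord0 i); exists k0 => // k /= k0k.
rewrite branch_pointE// /ball /=; apply: (@le_lt_trans _ _ (e / 2)%R); last first.
  by rewrite gtr_pMr// invf_lt1// ltr1n.
by apply: (hk (br t k0)); rewrite ?size_branch//; exact: branch_cell.
Qed.

Lemma measurable_limit_map : measurable_fun setT limit_map.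
Proof.
apply: measurable_fun_rVP => i.
apply: (measurable_fun_cvg (h := fun k => branch_point i k)) => // t _.
by rewrite mxE; exact: cvg_branch_point.
Qed.

(** The limit may fall outside the cell, but the cells containing the branch
    shrink to it uniformly in t. *)
Lemma limit_map_near (e : R) : (0 < e)%R -> exists k0, forall k, (k0 <= k)%N ->
  forall t, (0 <= t < 1)%R -> forall x, cl (br t k) x ->
  forall i, (`|x ord0 i - limit_map t ord0 i| <= e)%R.
Proof.
move=> e0; have [k0 hk] := @small_cells R d a e e0.
exists k0 => k k0k t t01 x xk i; rewrite mxE.
have hl : (fun j => `|x ord0 i - branch_point i j t|)%R @ \oo -->
    (`|x ord0 i - limn (fun j => branch_point i j t)|)%R.
  by apply: cvg_norm; apply: cvgB; [exact: cvg_cst|exact: cvg_branch_point].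
apply: (@ler_cvg_to _ _ _ _ _ (cst e) _ _ hl (cvg_cst _)); exists k => // j /= kj.
by rewrite branch_pointE//; apply: (hk (br t k)); rewrite ?size_branch//; exact: branch_cell.
Qed.

Lemma limit_map_box t : (0 <= t < 1)%R -> box a (limit_map t).
Proof.
move=> t01 i; rewrite mxE.
have pb k : (0 <= branch_point i k t <= a)%R.
  by rewrite branch_pointE//; apply: (cell_sub (ptP k t01)).
apply/andP; split.
  by apply: limr_ge; [exact: cvg_branch_point|apply: nearW => k; have /andP[] := pb k].
by apply: limr_le; [exact: cvg_branch_point|apply: nearW => k; have /andP[] := pb k].
Qed.

(** On [0, 1[ x [0, 1[ only the term of the two branches survives. *)
Definition cell_inf_sum k (s : measurableTypeR R * measurableTypeR R) : \bar R :=
  \sum_(z : pairs k) (cell_inf K a k z.1 z.2)%:E * (\1_(sl z.1 `*` sl z.2) s)%:E.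

Let cell_inf_sumE k s t : (0 <= s < 1)%R -> (0 <= t < 1)%R ->
  cell_inf_sum k (s, t) = (cell_inf K a k (br s k) (br t k))%:E.
Proof.
move=> s01 t01; rewrite /cell_inf_sum (bigD1 (brt s k, brt t k))//= !brtE.
rewrite indicE mem_set ?mule1/=; last by split => /=; exact: slot_branch.
rewrite big1 ?adde0// => -[w w'] /= ne; rewrite indicE memNset ?mule0//= => -[/= h1 h2].
move: h1 h2; rewrite !sl_uniq// -!brtE => /val_inj e1 /val_inj e2.
by rewrite e1 e2 eqxx in ne.
Qed.

Let cell_inf_sum_ge0 k s : 0 <= cell_inf_sum k s.
Proof.
by apply: sume_ge0 => z _; rewrite mule_ge0 ?lee_fin ?cell_inf_ge0// indicE.
Qed.

(** For large k, all differences of points of the cells of s and t are close to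
    the difference of the limits, where K exceeds any b below its value there. *)
Lemma limit_map_lsc s t : (0 <= s < 1)%R -> (0 <= t < 1)%R ->
  K (limit_map s - limit_map t)%R <= limn_einf (fun k => cell_inf_sum k (s, t)).
Proof.
move=> s01 t01; apply: le_by_reals => b /Klsc[V /nbhs_ballP[e /= e0 eV] VK].
have [k0 hk] := @limit_map_near (e / 3)%R (divr_gt0 e0 (ltr0Sn _ _)).
apply: (@limn_einf_ge _ _ _ (maxn k0 (Num.truncn b).+1)) => k.
rewrite geq_max => /andP[k0k bk]; rewrite cell_inf_sumE// (cell_infE K0) le_min lee_fin.
apply/andP; split.
  by apply: ltW; rewrite (lt_le_trans (truncnS_gt b))// ler_nat.
apply: le_ereal_inf_tmp => _ [[x y] [/= sx ty] <-]; apply: ltW; apply: VK; apply: eV.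
split=> // i j; rewrite (ord1 i) /ball /=.
have h1 := hk _ k0k _ s01 _ sx j; have h2 := hk _ k0k _ t01 _ ty j.
rewrite distrC in h1.
rewrite (_ : _ - _ = (limit_map s ord0 j - x ord0 j) +
  (y ord0 j - limit_map t ord0 j))%R; last by rewrite !mxE; ring.
apply: le_lt_trans (ler_normD _ _) _.
apply: le_lt_trans (lerD h1 h2) _.
by rewrite -subr_gt0 (_ : _ - _ = e / 3)%R ?divr_gt0//; field.
Qed.

Let P : probability (measurableTypeR R) R := @unit_measure R.

Let P_slot w : P (sl w) = (p w)%:E.
Proof.
rewrite -(lebesgue_slot p_ge0) //; apply: unit_measureE => t.
by move=> /(branch_uniq p_ge0 p_nil p_split)[]; rewrite /= in_itv.
Qed.

Let measurable_cell_inf_sum k : measurable_fun setT (cell_inf_sum k).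
Proof.
apply: emeasurable_sum => z.
apply: emeasurable_funM; first exact: measurable_cst.
apply/measurable_EFinP; apply: measurable_indic; apply: measurableX; exact: measurable_slot.
Qed.

Let integral_cell_inf_sum k : \int[P \x P]_s cell_inf_sum k s =
  (\sum_(z : pairs k) cell_inf K a k z.1 z.2 * (p z.1 * p z.2))%:E.
Proof.
have mX (z : pairs k) : measurable (sl z.1 `*` sl z.2 : set (measurableTypeR R * measurableTypeR R)).
  by apply: measurableX; exact: measurable_slot.
rewrite ge0_integral_sum//.
- rewrite -sumEFin; apply: eq_bigr => z _.
  rewrite ge0_integralZl_EFin//; last exact: cell_inf_ge0.
  + rewrite integral_indic// setIT EFinM; congr (_ * _).
    rewrite EFinM -!P_slot.
    by apply: (@product_measure1E _ _ _ _ R P P); exact: measurable_slot.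
  + by apply/measurable_EFinP; apply: measurable_indic.
- move=> z; apply: emeasurable_funM; first exact: measurable_cst.
  by apply/measurable_EFinP; apply: measurable_indic.
- by move=> z s _; rewrite mule_ge0 ?lee_fin ?cell_inf_ge0// indicE.
Qed.

Let X : {mfun measurableTypeR R >-> T} :=
  HB.pack limit_map (isMeasurableFun.Build _ _ _ _ limit_map measurable_limit_map).

Let law : probability T R := distribution P X.

Let law_box : law (~` box a) = 0.
Proof.
rewrite /law /distribution /= /pushforward; apply: unit_measure_out.
rewrite -subset0 => t [] /= nb; rewrite in_itv/= => t01.
exact/nb/limit_map_box.
Qed.

(** Fatou's lemma on the product of the unit interval with itself, applied to the
    step functions [cell_inf_sum], whose integrals are the discrete energies. *)
Lemma energy_limit_law (I : R) :
  (forall k, \sum_(z : pairs k) cell_inf K a k z.1 z.2 * (p z.1 * p z.2) <= I)%R ->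
  exists mu : probability T R, mu (~` box a) = 0 /\ energy K mu mu <= I%:E.
Proof.
move=> hI; exists law; split => //.
rewrite /law energy_distribution//.
pose f (s : measurableTypeR R * measurableTypeR R) := K (limit_map s.1 - limit_map s.2)%R.
have mf : measurable_fun setT f.
  exact: (measurableT_comp (measurable_kernel mK)
    (measurable_fun_pair (measurableT_comp measurable_limit_map measurable_fst)
      (measurableT_comp measurable_limit_map measurable_snd))).
rewrite -/P (_ : \int[P]_s _ = \int[P \x P]_s f s); last first.
  by rewrite (fubini_tonelli1 _ mf (fun=> K0 _)).
pose D : set (measurableTypeR R * measurableTypeR R) :=
  `[0%R, 1%R[%classic `*` `[0%R, 1%R[%classic.
have mI : measurable (`[0%R, 1%R[%classic : set (measurableTypeR R)).
  exact: measurable_itv.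
have mD : measurable D by exact: measurableX.
have D1 : (P \x P) (~` D) = 0.
  have P0 : P (~` `[0%R, 1%R[%classic) = 0.
    by apply: unit_measure_out; rewrite setICl.
  have mC : measurable (~` `[0%R, 1%R[%classic : set (measurableTypeR R)).
    exact: measurableC.
  have -> : ~` D = (~` `[0%R, 1%R[%classic `*` setT) `|` (setT `*` ~` `[0%R, 1%R[%classic).
    rewrite /D; apply/seteqP; split => -[s t] /=.
      by move=> /not_andP[h|h]; [left|right].
    by move=> [[h _]|[_ h]] [].
  rewrite (@measureU0 _ _ _ (P \x P)).
  - apply: etrans (@product_measure1E _ _ _ _ R P P _ _ mC measurableT) _.
    by rewrite [X in X * _]P0 mul0e.
  - exact: measurableX.
  - exact: measurableX.
  - apply: etrans (@product_measure1E _ _ _ _ R P P _ _ measurableT mC) _.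
    by rewrite [X in _ * X]P0 mule0.
rewrite (ge0_negligible_integral (measurableC mD) measurableT mf _ D1)//; last first.
  by move=> *; exact: K0.
rewrite setTD setCK.
apply: (@le_trans _ _ (\int[P \x P]_(s in D) limn_einf (fun k => cell_inf_sum k s))).
  apply: ge0_le_integral => //.
  - by move=> *; exact: K0.
  - exact: measurable_funTS.
  - apply: measurable_funTS; rewrite /limn_einf.
    apply: (measurableT_comp (@oppe_measurable R setT)).
    apply: measurable_fun_limn_esup => k.
    exact: (measurableT_comp (@oppe_measurable R setT) (measurable_cell_inf_sum k)).
  - move=> [s t] [/=]; rewrite !in_itv/= => s01 t01; exact: limit_map_lsc.
apply: le_trans (fatou _ _ _ _) _ => //.
  by move=> k; apply: measurable_funTS.
apply: limn_einf_le => k.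
apply: (@le_trans _ _ (\int[P \x P]_s cell_inf_sum k s)).
  by apply: ge0_subset_integral.
by rewrite integral_cell_inf_sum lee_fin.
Qed.

End Realisation.
Lemma probability_full {dd : measure_display} {X : measurableType dd} {R : realType}
    (P : probability X R) (A : set X) : measurable A -> P (~` A) = 0 -> P A = 1.
Proof.
move=> mA PA; rewrite -(probability_setT P) -(setvU A) measureU ?setICl//.
  by rewrite -[LHS]add0e; congr (_ + _); exact/esym.
exact: measurableC.
Qed.

(** * Minimisers on a box *)

Section BoxMinimiser.
Context {R : realType} {d : nat}.
Local Notation T := 'rV[R]_d.
Variable K : T -> \bar R.
Hypothesis mK : measurable_fun setT K.
Hypothesis K0 : forall x, 0 <= K x.
Hypothesis Klsc : lower_semicontinuous K.
Variable a : R.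
Local Notation cl := (cell (box a) (@rat_halfspace R d)).

(** The ultrafilter limits p of the cell masses satisfy the hypotheses of the
    realisation, and the discrete energies pass to the limit. *)
Lemma energy_limit (mu_ : nat -> probability T R) (I : R) :
  (forall n, mu_ n (~` box a) = 0) ->
  (forall n, energy K (mu_ n) (mu_ n) <= (I + n.+1%:R^-1)%:E) ->
  exists mu : probability T R, mu (~` box a) = 0 /\ energy K mu mu <= I%:E.
Proof.
move=> mu0 muI.
have mb := @measurable_box R d a.
have mh := @measurable_rat_halfspace R d.
have mcl := measurable_cell mb mh.
have [U [UU sU]] := @ultraFilterLemma nat \oo _.
have mu01 w n : (0 <= fine (mu_ n (cl w)) <= 1)%R.
  rewrite fine_ge0//= -lee_fin fineK ?fin_num_measure//.
  exact: probability_le1.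
have /choice[p pl] : forall w, exists l : R, fine (mu_ n (cl w)) @[n --> U] --> l.
  by move=> w; exact: ultra_cvg.
have p_ge0 w : (0 <= p w)%R.
  apply: (ler_cvg_to (cvg_cst 0%R) (pl w)); apply: (@filterS _ U _ setT).
    by move=> n _; have /andP[] := mu01 w n.
  exact: filterT.
apply: (@energy_limit_law R d K mK K0 Klsc a p) => //.
- apply: (cvg_unique _ (pl [::])) => //.
  rewrite (_ : (fun n => _) = cst 1%R); last first.
    by apply/funext => n; rewrite /= (probability_full mb (mu0 n)).
  exact: cvg_cst.
- move=> w; apply: (cvg_unique _ (pl w)) => //.
  rewrite (_ : (fun n => _) = (fun n => fine (mu_ n (cl (true :: w))) +
    fine (mu_ n (cl (false :: w))))%R); last first.
    by apply/funext => n; rewrite (cell_split (mu_ n) mb mh w) fineD ?fin_num_measure.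
  exact: cvgD.
- move=> w pw; apply/set0P/negP => /eqP w0; move: pw.
  suff -> : p w = 0%R by rewrite ltxx.
  apply: (cvg_unique _ (pl w)) => //.
  rewrite (_ : (fun n => _) = cst 0%R); last first.
    by apply/funext => n; rewrite w0 measure0.
  exact: cvg_cst.
move=> k.
pose u n := (\sum_(z : k.-tuple bool * k.-tuple bool)
  cell_inf K a k z.1 z.2 * (fine (mu_ n (cl z.1)) * fine (mu_ n (cl z.2))))%R.
have uE n : (u n <= I + n.+1%:R^-1)%R.
  rewrite -lee_fin; apply: le_trans (muI n).
  apply: le_trans (cell_energy_le mK K0 a (mu_ n) k).
  rewrite /u -sumEFin; apply: lee_sum => z _.
  have fE w : (fine (mu_ n (cl w)))%:E = mu_ n (cl w).
    by rewrite fineK// fin_num_measure.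
  by rewrite EFinM [X in _ * X]EFinM !fE.
apply: (@ler_cvg_to _ U _ _ u (fun n => I + n.+1%:R^-1)%R).
- apply: cvg_bigsum => z; apply: cvgM; first exact: cvg_cst.
  by apply: cvgM; exact: pl.
- rewrite -[X in _ --> X]addr0; apply: cvgD; first exact: cvg_cst.
  by move=> A /(@cvg_harmonic R); exact: sU.
- by apply: (@filterS _ U _ setT) => [n _|]; [exact: uE|exact: filterT].
Qed.

Lemma exists_box_minimiser : (0 <= a)%R ->
  exists mu : probability T R, mu (~` box a) = 0 /\
    forall nu : probability T R, nu (~` box a) = 0 ->
      energy K mu mu <= energy K nu nu.
Proof.
move=> a0.
pose S := [set energy K nu nu | nu in [set nu : probability T R | nu (~` box a) = 0]].
have [Soo|] := pselect (forall e, S e -> e = +oo).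
  have d0 : (\d_(0%R : T) : probability T R) (~` box a) = 0.
    rewrite /= diracE memNset//= => -[] i; rewrite mxE lexx.
    exact: a0.
  exists \d_(0%R : T); split; first exact: d0.
  by move=> nu nu0; rewrite [leRHS](Soo _)//; [exact: leey|exists nu].
move=> /existsNP[_ /not_implyP[[nu0 /= nu0Q <-] nu0oo]].
have S0 : 0 <= ereal_inf S by apply: le_ereal_inf_tmp => _ [nu _ <-]; exact: energy_ge0.
have Sfin : ereal_inf S \is a fin_num.
  rewrite ge0_fin_numE//; apply: (@le_lt_trans _ _ (energy K nu0 nu0)).
    by apply: ereal_inf_lbound; exists nu0.
  by rewrite ltey; apply/eqP.
pose I := fine (ereal_inf S).
have IE : ereal_inf S = I%:E by rewrite fineK.
have /choice[mu_ mu_P] : forall n : nat, exists nu : probability T R,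
    nu (~` box a) = 0 /\ energy K nu nu <= (I + n.+1%:R^-1)%:E.
  move=> n; have e0 : (0 < n.+1%:R^-1 :> R)%R by rewrite invr_gt0.
  have [_ [nu nuQ <-] h] := lb_ereal_inf_adherent e0 Sfin.
  by exists nu; split => //; rewrite EFinD -IE ltW.
have [mu [muQ muI]] := energy_limit (fun n => (mu_P n).1) (fun n => (mu_P n).2).
exists mu; split => // nu nuQ; apply: le_trans muI _; rewrite -IE.
by apply: ereal_inf_lbound; exists nu.
Qed.

End BoxMinimiser.
(** Strict monotonicity of the integral, for a comparison that may fail on a null
    set N. *)
Lemma null_of_strict_le {dd : measure_display} {X : measurableType dd} {R : realType}
    (M : {measure set X -> \bar R}) (g1 g2 : X -> \bar R) (N E : set X) :
  measurable_fun setT g1 -> measurable_fun setT g2 ->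
  (forall x, 0 <= g1 x) -> (forall x, 0 <= g2 x) ->
  measurable N -> M N = 0 -> (forall x, ~ N x -> g1 x <= g2 x) ->
  measurable E -> (forall x, E x -> g1 x < g2 x) ->
  \int[M]_x g2 x < +oo -> \int[M]_x g2 x <= \int[M]_x g1 x -> M E = 0.
Proof.
move=> mg1 mg2 g10 g20 mN MN g12 mE Elt fin2 le21.
have mCE : measurable (~` E) by exact: measurableC.
have split g : measurable_fun setT g -> (forall x, 0 <= g x) ->
    \int[M]_x g x = \int[M]_(x in E) g x + \int[M]_(x in ~` E) g x.
  move=> mg g0; rewrite -[in LHS](setUv E) ge0_integral_setU//.
  - by rewrite setUv.
  - by apply/disj_setPS => x [].
have leC : \int[M]_(x in ~` E) g1 x <= \int[M]_(x in ~` E) g2 x.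
  apply: ae_ge0_le_integral => //; try exact: measurable_funTS.
  exists N; split => // x /= h; apply: contrapT => Nx; apply: h => _.
  exact: g12.
have fE g (A : set X) : measurable A -> measurable_fun setT g -> (forall x, 0 <= g x) ->
    \int[M]_x g x < +oo -> \int[M]_(x in A) g x \is a fin_num.
  move=> mA mg g0 gf; rewrite ge0_fin_numE ?integral_ge0//.
  apply: le_lt_trans gf; exact: ge0_subset_integral.
have fC2 := fE g2 _ mCE mg2 g20 fin2.
have f2 := fE g2 _ mE mg2 g20 fin2.
have le21E : \int[M]_(x in E) g2 x <= \int[M]_(x in E) g1 x.
  rewrite -(leeD2rE _ _ fC2) -(split _ mg2 g20) (le_trans le21)//.
  by rewrite (split _ mg1 g10) leeD2l.
pose h x := g2 x - g1 x.
have mh : measurable_fun E h.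
  by apply: emeasurable_funB; exact: measurable_funTS.
have g1f x : E x -> g1 x \is a fin_num.
  by move=> Ex; rewrite ge0_fin_numE// (lt_le_trans (Elt _ Ex))// leey.
have h0 x : E x -> 0 <= h x.
  by move=> Ex; rewrite /h sube_ge0 ?g1f// ltW// Elt.
have eqh : \int[M]_(x in E) g2 x = \int[M]_(x in E) g1 x + \int[M]_(x in E) h x.
  rewrite -ge0_integralD//; try exact: measurable_funTS.
  apply: eq_integral => x; rewrite inE => Ex.
  by rewrite /h addeC subeK// g1f.
have hz : \int[M]_(x in E) h x = 0.
  have hp : 0 <= \int[M]_(x in E) h x by exact: integral_ge0.
  have f1 : \int[M]_(x in E) g1 x \is a fin_num.
    rewrite ge0_fin_numE ?integral_ge0//.
    by apply: le_lt_trans (_ : _ <= \int[M]_(x in E) g2 x) _; [rewrite eqh leeDl|rewrite -ge0_fin_numE// integral_ge0].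
  apply/eqP; rewrite eq_le hp andbT.
  by rewrite -(leeD2lE _ _ f1) adde0 -eqh.
have : \int[M]_(x in E) `|h x| = 0.
  rewrite -[RHS]hz; apply: eq_integral => x; rewrite inE => Ex.
  by rewrite gee0_abs// h0.
move=> /(ae_eq_integral_abs M mE mh) => aeh.
apply: measure_negligible => //.
apply: negligibleS aeh => x Ex /= /(_ Ex); rewrite /h /= => e.
by have := Elt x Ex; rewrite -sube_gt0 e ltxx.
Qed.
(** * Confinement of minimisers *)

Lemma measurable_preimage {d1 d2 : measure_display} {X : measurableType d1}
    {Y : measurableType d2} (f : X -> Y) (B : set Y) :
  measurable_fun setT f -> measurable B -> measurable (f @^-1` B).
Proof. by move=> mf mB; rewrite -[X in measurable X]setTI; exact: mf. Qed.

Lemma middle_bin (j0 l i j : nat) : (j0 + 3 * l <= j)%N -> (i < l)%N ->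
  (j0 <= (j0 + 3 * i).+1 <= j)%N.
Proof. lia. Qed.

Section Translation.
Context {R : realType} {d : nat}.
Local Notation T := 'rV[R]_d.

Lemma measurable_translate (v : T) : measurable_fun setT (fun x : T => x - v)%R.
Proof.
apply: measurable_fun_rVP => i; under eq_fun do rewrite !mxE.
by apply: measurable_funB => //; exact: measurable_coord.
Qed.

Definition translate (v : T) : {mfun T >-> T} := HB.pack (fun x : T => x - v)%R
  (isMeasurableFun.Build _ _ _ _ (fun x : T => x - v)%R (measurable_translate v)).

Lemma energy_translate (K : T -> \bar R) (mu : probability T R) (v : T) :
  measurable_fun setT K -> (forall x, 0 <= K x) ->
  energy K (distribution mu (translate v)) (distribution mu (translate v)) =
  energy K mu mu.
Proof.
move=> mK K0; rewrite (energy_distribution mK K0 mu (translate v)) /energy /potential.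
apply: eq_integral => x _; apply: eq_integral => y _.
by congr K; rewrite /= opprB addrA subrK.
Qed.

Lemma box_subset (a b : R) : (a <= b)%R -> box a `<=` (box b : set T).
Proof. by move=> ab x ax i; have /andP[-> /le_trans ->] := ax i. Qed.

Lemma box_concentrated (mu : probability T R) (a b : R) : (a <= b)%R ->
  mu (~` box a) = 0 -> mu (~` box b) = 0.
Proof.
move=> ab; apply: subset_measure0; last exact/subsetC/box_subset.
  by apply: measurableC; exact: measurable_box.
by apply: measurableC; exact: measurable_box.
Qed.

End Translation.

Section Confinement.
Context {R : realType} {d : nat}.
Local Notation T := 'rV[R]_d.
Variable K : T -> \bar R.
Hypothesis mK : measurable_fun setT K.
Hypothesis K0 : forall x, 0 <= K x.
Hypothesis Ke : forall x, K x = K (- x)%R.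
Variable R6 : R.
Hypothesis R6_gt0 : (0 < R6)%R.
Hypothesis Kincr : forall (k : 'I_d) (x y : T),
  (forall j, j != k -> x ord0 j = y ord0 j) ->
  (R6 <= x ord0 k)%R -> (x ord0 k < y ord0 k)%R -> K x < K y.
Variables (D A : R).
Hypothesis R6D : (R6 + R6 <= D)%R.
Hypothesis A_gt0 : (0 < A)%R.
Hypothesis Kfar : forall (x : T) (i : 'I_d), (D <= `|x ord0 i|)%R -> A%:E <= K x.

Let D_gt0 : (0 < D)%R.
Proof. by rewrite (lt_le_trans _ R6D)// addr_gt0. Qed.

Variables (a f c : R) (mu : probability T R).
Hypothesis mu_box : mu (~` box a) = 0.
Hypothesis mu_f : energy K mu mu = f%:E.
Hypothesis mu_min : forall nu : probability T R,
  nu (~` box a) = 0 -> f%:E <= energy K nu nu.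
Hypothesis fc : (f < c)%R.

Let window (x : T) : set T := [set y | forall i, (`|x ord0 i - y ord0 i| < D)%R].

Let measurable_window x : measurable (window x).
Proof.
have -> : window x = [set y : T | forall i, ball (x ord0 i) D (y ord0 i)] by [].
apply: (@measurable_forall_coord R d (fun i => ball (x ord0 i) D)) => i.
by apply: open_measurable; exact: ball_open.
Qed.

(** The part of mu at distance at least D from x contributes at least A times its
    mass to the potential at x. *)
Lemma window_mass x : potential K mu x < c%:E -> (1 - c / A)%:E <= mu (window x).
Proof.
move=> xc; have mC : measurable (~` window x) by exact: measurableC.
have h1 : A%:E * mu (~` window x) <= potential K mu x.
  rewrite -integral_cst//; apply: (@le_trans _ _ (\int[mu]_(y in ~` window x) K (x - y)%R)).
    apply: ge0_le_integral => //.
    - by move=> y _; rewrite lee_fin ltW.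
    - by apply: measurable_funTS; exact: measurable_kernel_l.
    - move=> y /= /existsNP[i /negP]; rewrite -leNgt => h.
      by apply: (@Kfar _ i); rewrite !mxE.
  by apply: ge0_subset_integral => //; exact: measurable_kernel_l.
have := le_lt_trans h1 xc; rewrite probability_setC//.
have [b bE] : exists b, mu (window x) = b%:E.
  by exists (fine (mu (window x))); rewrite fineK// fin_num_measure.
rewrite bE -EFinB -EFinM lte_fin lee_fin => h.
by rewrite lerBlDl -lerBlDr -(ler_pM2l A_gt0) [leRHS]mulrC divfK ?gt_eqF// ltW.
Qed.

Definition slab (k : 'I_d) (s t : R) : set T := [set x | (s <= x ord0 k < t)%R].

Lemma measurable_slab k s t : measurable (slab k s t).
Proof.
have -> : slab k s t = [set x : T | (`[s, t[%classic : set R) (x ord0 k)].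
  by apply/seteqP; split => x /=; rewrite /slab /= in_itv.
exact: measurable_coord_set.
Qed.

(** Almost every point has potential less than c, so a slab of positive mass
    contains one, and the window around it stays in the enlarged slab. *)
Lemma slab_mass k s t : mu (slab k s t) != 0 ->
  (1 - c / A)%:E <= mu (slab k (s - D)%R (t + D)%R).
Proof.
move=> m0; have ms := measurable_slab k s t.
have [x [sx xc]] : exists x, slab k s t x /\ potential K mu x < c%:E.
  apply: contrapT => /forallNP h; move/eqP: m0; apply.
  have mub := minimiser_potential_upper mK K0 Ke (measurable_box a) mu_box mu_f mu_min fc.
  apply: (subset_measure0 (B := [set x | c%:E <= potential K mu x])) => //.
    rewrite -[X in measurable X]setTI; apply: emeasurable_fun_c_infty => //.
    exact: measurable_potential.
  by move=> x sx /=; rewrite leNgt; apply/negP => xc; exact: (h x).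
apply: le_trans (window_mass xc) _; apply: le_measure; rewrite ?inE//.
  exact: measurable_slab.
move=> y /(_ k); rewrite ltr_distl /slab /= => /andP[h1 h2].
by move: sx => /andP[h3 h4]; apply/andP; split; lra.
Qed.

(** Moves the half-space x_k >= t by R6 towards the other one.  Across an empty slab
    of width D >= 2 R6 all differences x_k - y_k remain at least R6, the range
    where K is increasing. *)
Definition close_gap (k : 'I_d) (t : R) (x : T) : T :=
  \row_i (x ord0 i - (R6 *+ (i == k)) * \1_[set y : T | (t <= y ord0 k)%R] x)%R.

Lemma measurable_close_gap k t : measurable_fun setT (close_gap k t).
Proof.
apply: measurable_fun_rVP => i; under eq_fun do rewrite mxE.
apply: measurable_funB; first exact: measurable_coord.
apply: measurable_funM; first exact: measurable_cst.
by apply: measurable_indic; exact: measurable_coord_ge.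
Qed.

Let close_gap_left k (t : R) (x : T) : (x ord0 k < t)%R -> close_gap k t x = x.
Proof.
move=> xt; apply/rowP => i; rewrite mxE indicE memNset ?mulr0 ?subr0//=.
by rewrite leNgt xt.
Qed.

Let close_gap_right k (t : R) (x : T) : (t <= x ord0 k)%R ->
  close_gap k t x = \row_i (x ord0 i - R6 *+ (i == k))%R.
Proof. by move=> xt; apply/rowP => i; rewrite !mxE indicE mem_set ?mulr1. Qed.

Let close_gap_strict k (s t : R) (x y : T) : (s + D <= t)%R -> (t <= x ord0 k)%R -> (y ord0 k < s)%R ->
  K (close_gap k t x - close_gap k t y)%R < K (x - y)%R.
Proof.
move=> st tx ys; rewrite close_gap_right// close_gap_left; last first.
  by have := D_gt0; lra.
apply: (Kincr (k := k)).
- by move=> j jk; rewrite !mxE (negbTE jk) mulr0n subr0.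
- have h : (R6 <= x ord0 k - R6 - y ord0 k)%R by have := R6D; lra.
  by rewrite !mxE eqxx mulr1n.
- have h : (x ord0 k - R6 - y ord0 k < x ord0 k - y ord0 k)%R by have := R6_gt0; lra.
  by rewrite !mxE eqxx mulr1n.
Qed.

Let close_gap_le k (s t : R) (x y : T) : (s + D <= t)%R ->
  ~ slab k s t x -> ~ slab k s t y ->
  K (close_gap k t x - close_gap k t y)%R <= K (x - y)%R.
Proof.
move=> st; rewrite /slab /= => /negP; rewrite negb_and -ltNge -leNgt.
move=> /orP xs /negP; rewrite negb_and -ltNge -leNgt => /orP ys.
have sltt : (s < t)%R by have := D_gt0; lra.
case: xs ys => [xs|xs] [ys|ys].
- by rewrite !close_gap_left// (lt_trans _ sltt).
- rewrite Ke opprB [leRHS]Ke opprB; apply: ltW; exact: close_gap_strict st ys xs.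
- apply: ltW; exact: close_gap_strict st xs ys.
- rewrite !close_gap_right// (_ : _ - _ = x - y)%R//.
  by apply/rowP => i; rewrite !mxE opprB addrA subrK.
Qed.

(** Closing an empty slab would strictly decrease the energy of the pairs lying on
    opposite sides and keep that of all other pairs. *)
Lemma no_gap k (s t : R) : (s + D <= t)%R -> (0 <= s)%R ->
  mu [set x : T | (x ord0 k < s)%R] != 0 -> mu [set x : T | (t <= x ord0 k)%R] != 0 ->
  mu (slab k s t) != 0.
Proof.
move=> st s0 left0 right0; apply/negP => /eqP gap0.
have mcg := measurable_close_gap k t.
pose S : {mfun T >-> T} :=
  HB.pack (close_gap k t) (isMeasurableFun.Build _ _ _ _ (close_gap k t) mcg).
pose nu : probability T R := distribution mu S.
have nubox : nu (~` box a) = 0.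
  apply: (subset_measure0 (B := ~` box a)) mu_box => //.
  - by apply: (measurable_preimage (measurable_close_gap k t)); apply: measurableC; exact: measurable_box.
  - by apply: measurableC; exact: measurable_box.
  move=> x /= nb bx; apply: nb => i.
  have [xt|xt] := ltP (x ord0 k) t; first by rewrite close_gap_left.
  rewrite close_gap_right// mxE; have /andP[b0 ba] := bx i.
  have [ik|ik] := eqVneq i k; last by rewrite mulr0n subr0 b0.
  rewrite mulr1n ik in b0 ba *; have := R6D; have := R6_gt0.
  by move=> *; apply/andP; split; lra.
have le1 := mu_min nubox; rewrite /nu energy_distribution// in le1.
pose g1 (z : T * T) := K (close_gap k t z.1 - close_gap k t z.2)%R.
pose g2 (z : T * T) := K (z.1 - z.2)%R.
have mg1 : measurable_fun setT g1.
  exact: (measurableT_comp (measurable_kernel mK)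
    (measurable_fun_pair (measurableT_comp mcg measurable_fst)
      (measurableT_comp mcg measurable_snd))).
have g1E : \int[mu]_x \int[mu]_y K (close_gap k t x - close_gap k t y)%R =
    \int[mu \x mu]_z g1 z.
  by rewrite (fubini_tonelli1 _ mg1 (fun=> K0 _)).
have msl := measurable_slab k s t.
pose N : set (T * T) := (slab k s t `*` setT) `|` (setT `*` slab k s t).
have mN1 : measurable (slab k s t `*` setT : set (T * T)) by exact: measurableX.
have mN2 : measurable (setT `*` slab k s t : set (T * T)) by exact: measurableX.
have mN : measurable N by exact: measurableU.
have MN : (mu \x mu) N = 0.
  rewrite /N (@measureU0 _ _ _ (mu \x mu))//.
  - by apply: etrans (product_measure1E mu mu msl measurableT) _; rewrite [X in X * _]gap0 mul0e.
  - by apply: etrans (product_measure1E mu mu measurableT msl) _; rewrite [X in _ * X]gap0 mule0.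
pose El := [set x : T | (x ord0 k < s)%R].
pose Er := [set x : T | (t <= x ord0 k)%R].
have mEl : measurable El by exact: measurable_coord_lt.
have mEr : measurable Er by exact: measurable_coord_ge.
have : (mu \x mu) (Er `*` El) = 0.
  apply: (@null_of_strict_le _ _ _ (mu \x mu) g1 g2 N) => //.
  - exact: measurable_kernel.
  - by move=> z; exact: K0.
  - by move=> z; exact: K0.
  - move=> [x y] /= /not_orP[nx ny]; apply: (@close_gap_le k s t) => //.
    + by move=> sx; apply: nx.
    + by move=> sy; apply: ny.
  - exact: measurableX.
  - by move=> [x y] [/= xr yl]; exact: close_gap_strict st xr yl.
  - by rewrite -(energyE mK K0) mu_f ltry.
  - by rewrite -g1E -(energyE mK K0) mu_f.
move=> E0; have := etrans (esym (product_measure1E mu mu mEr mEl)) E0.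
by move=> /eqP; rewrite mule_eq0 (negbTE left0) (negbTE right0).
Qed.

Variable l : nat.
Hypothesis l_large : (1 < l%:R * (1 - c / A))%R.

Let bin k (j : nat) : set T := slab k (j%:R * D)%R (j.+1%:R * D)%R.

Let bins_cover k (x : T) : (0 <= x ord0 k)%R -> exists j, bin k j x.
Proof.
move=> x0; exists (Num.truncn (x ord0 k / D)).
have /truncn_itv/andP[h1 h2] : (0 <= x ord0 k / D)%R by rewrite divr_ge0// ltW.
by rewrite /bin /slab /= -ler_pdivlMr// h1 -ltr_pdivrMr.
Qed.

Let mu_neq0_le (B C : set T) : measurable B -> measurable C -> B `<=` C ->
  mu B != 0 -> mu C != 0.
Proof.
by move=> mB mC BC; apply: contra => /eqP C0; apply/eqP; apply: (subset_measure0 (B := C)).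
Qed.

(** The bins of positive mass are consecutive by [no_gap].  Were there more than 3 l of
    them, l disjoint groups of three would each have mass at least 1 - c / A by
    [slab_mass] applied to the middle one. *)
Lemma occupied_bins k : exists j0 : nat, forall j, mu (bin k j) != 0 ->
  (j0 <= j < j0 + 3 * l)%N.
Proof.
have mbin j : measurable (bin k j) by exact: measurable_slab.
have ex : exists j, mu (bin k j) != 0.
  apply: contrapT => /forallNP h.
  have : mu.-negligible (\bigcup_j bin k j).
    apply: negligible_bigcup => j; exists (bin k j); split => //.
    by have /negP := h j; rewrite negbK => /eqP.
  move=> /(@negligibleS _ _ _ mu _ (box a)) ng.
  have mb : mu (box a) = 0.
    apply: measure_negligible; first exact: measurable_box.
    apply: ng => x bx; have [j xj] := @bins_cover k x (proj1 (andP (bx k))).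
    by exists j.
  have := probability_full (measurable_box a) mu_box; rewrite mb => /eqP.
  by rewrite eq_sym onee_eq0.
case: (ex_minnP ex) => j0 mj0 j0min; exists j0 => j mj.
rewrite j0min//= ltnNge; apply/negP => jl.
have leD (m n : nat) : (m <= n)%N -> (m%:R * D <= n%:R * D)%R.
  by move=> mn; rewrite ler_wpM2r ?ler_nat// ltW.
have mhalf := @measurable_coord_lt R d k.
have mhalf' := @measurable_coord_ge R d k.
have between i : (j0 <= i <= j)%N -> mu (bin k i) != 0.
  move=> /andP[]; rewrite leq_eqVlt => /orP[/eqP<-//|ji].
  rewrite leq_eqVlt => /orP[/eqP->//|ij].
  apply: no_gap.
  - by rewrite -[X in (_ + X)%R]mul1r -mulrDl natr1.
  - by rewrite mulr_ge0// ltW.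
  - apply: mu_neq0_le mj0 => // x /andP[_ xj] /=.
    by rewrite (lt_le_trans xj)// leD.
  - apply: mu_neq0_le mj => // x /andP[xj _] /=.
    by rewrite (le_trans _ xj)// leD.
pose W (i : 'I_l) := slab k ((j0 + 3 * i)%:R * D)%R ((j0 + 3 * i.+1)%:R * D)%R.
have mW i : measurable (W i) by exact: measurable_slab.
have Wmass i : (1 - c / A)%:E <= mu (W i).
  have jj : (j0 <= (j0 + 3 * i).+1 <= j)%N.
    exact: middle_bin jl (ltn_ord i).
  have := slab_mass (between _ jj).
  rewrite /W; congr (_ <= mu (slab _ _ _)).
    by rewrite -natr1 mulrDl mul1r addrK.
  by rewrite -[X in (_ + X)%R]mul1r -mulrDl natr1; congr (_%:R * _)%R; rewrite mulnS -addn3 -addnA [(3 + _)%N]addnC.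
have tW i i' : i != i' -> W i `&` W i' = set0.
  wlog ii : i i' / (i < i')%N.
    move=> wl ne; have := ne; rewrite -val_eqE neq_ltn => /orP[ii|ii]; first exact: wl.
    by rewrite setIC; apply: wl => //; rewrite eq_sym.
  move=> _; rewrite -subset0 => x [/andP[_ x1] /andP[x2 _]].
  have ii' : (j0 + 3 * i.+1 <= j0 + 3 * i')%N by rewrite leq_add2l leq_mul2l.
  by have := lt_le_trans (le_lt_trans x2 x1) (leD _ _ ii'); rewrite ltxx.
have := @sum_le_integral _ _ _ mu _ W mW tW (fun=> 1%R) (cst 1%:E).
rewrite integral_cst// [X in _ * X]probability_setT mule1.
move=> /(_ (measurable_cst _) (fun=> lee01) (fun=> ler01)) h.
have {h} : \sum_(i < l) 1%:E * mu (W i) <= 1%:E by apply: h => i x _; exact: lexx.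
apply/negP; rewrite -ltNge.
apply: (@lt_le_trans _ _ (\sum_(i < l) (1 - c / A)%:E)).
  rewrite sumEFin lte_fin sumr_const card_ord -mulr_natl; exact: l_large.
by apply: lee_sum => i _; rewrite mul1e.
Qed.

Lemma confined_translate : exists nu : probability T R,
  nu (~` box ((3 * l)%:R * D)%R) = 0 /\ energy K nu nu = f%:E.
Proof.
have /choice[j0 j0P] := occupied_bins.
pose tau : T := \row_i ((j0 i)%:R * D)%R.
exists (distribution mu (translate tau)); split; last by rewrite energy_translate.
have mC : measurable (~` box ((3 * l)%:R * D)%R : set T).
  by apply: measurableC; exact: measurable_box.
have mSC : measurable (translate tau @^-1` (~` box ((3 * l)%:R * D)%R)).
  exact: (measurable_preimage (measurable_translate tau)).
apply: (measure_negligible (mu := mu)) => //.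
(* The exceptional points are those outside the box or in one of the countably
   many bins of mass zero. *)
pose bad (ij : 'I_d * nat) : set T :=
  if mu (bin ij.1 ij.2) == 0 then bin ij.1 ij.2 else set0.
have ngbad : mu.-negligible (\bigcup_n
    (if @unpickle ('I_d * nat)%type n is Some ij then bad ij else set0)).
  apply: negligible_bigcup => n; case: unpickle => [ij|]; last exact: negligible_set0.
  rewrite /bad; case: ifPn => [/eqP h|_]; last exact: negligible_set0.
  by exists (bin ij.1 ij.2); split => //; exact: measurable_slab.
have ngbox : mu.-negligible (~` box a).
  by exists (~` box a); split => //; apply: measurableC; exact: measurable_box.
apply: negligibleS (negligibleU ngbad ngbox) => x nb.
have [bx|] := pselect (box a x); last by right.
left; apply: contrapT => nbad; apply: nb => i /=.
have [j xj] := @bins_cover i x (proj1 (andP (bx i))).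
have mj : mu (bin i j) != 0.
  apply/negP => z; apply: nbad; exists (pickle (i, j)) => //.
  by rewrite pickleK /bad /= z.
have /andP[h1 h2] := j0P i j mj.
move: xj => /andP[x1 x2]; rewrite !mxE.
have d1 : ((j0 i)%:R * D <= j%:R * D)%R by rewrite ler_wpM2r ?ler_nat// ltW.
have d2 : (j.+1%:R * D <= (j0 i)%:R * D + (3 * l)%:R * D)%R.
  by rewrite -mulrDl -natrD ler_wpM2r ?ler_nat// ltW.
by rewrite subr_ge0 (le_trans d1 x1)/= lerBlDl (le_trans (ltW x2)).
Qed.

End Confinement.
(** * Minimisers on the whole space *)

Section GlobalMinimiser.
Context {R : realType} {d : nat}.
Local Notation T := 'rV[R]_d.
Variable K : T -> \bar R.
Hypothesis mK : measurable_fun setT K.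
Hypothesis K0 : forall x, 0 <= K x.

Definition cube (n : nat) : set T := [set x | forall i, (`|x ord0 i| <= n%:R)%R].

Lemma measurable_cube n : measurable (cube n).
Proof.
have -> : cube n = [set x : T | forall i,
    (`[(- n%:R)%R, n%:R%R]%classic : set R) (x ord0 i)].
  by apply/seteqP; split => x /= + i => /(_ i); rewrite in_itv/= ler_norml.
by apply: (@measurable_forall_coord R d (fun=> `[(- n%:R)%R, n%:R%R]%classic)) => i;
  exact: measurable_itv.
Qed.

Lemma cube_cover : \bigcup_n cube n = [set: T].
Proof.
apply/seteqP; split => // x _.
exists (\max_(i < d) (Num.truncn `|x ord0 i|).+1) => // i.
rewrite (le_trans (ltW (truncnS_gt _)))// ler_nat.
exact: (@leq_bigmax _ (fun i : 'I_d => (Num.truncn `|x ord0 i|).+1) i).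
Qed.

Lemma cvg_cube (mu : probability T R) : fine (mu (cube n)) @[n --> \oo] --> (1%R : R).
Proof.
have h : mu (cube n) @[n --> \oo] --> mu (\bigcup_n cube n).
  apply: nondecreasing_cvg_mu; first by move=> n; exact: measurable_cube.
    by apply: bigcup_measurable => n _; exact: measurable_cube.
  move=> m n mn; apply/subsetPset => x mx i.
  by rewrite (le_trans (mx i))// ler_nat.
rewrite cube_cover probability_setT in h.
exact: (fine_cvg h).
Qed.

(** Restrict nu to centred cubes and translate these into boxes: by homogeneity,
    g times the square of the mass of a cube is at most the energy of nu. *)
Lemma energy_ge_boxes (g : R) :
  (forall (M : nat) (eta : probability T R), eta (~` box M%:R) = 0 ->
    g%:E <= energy K eta eta) ->
  forall nu : probability T R, g%:E <= energy K nu nu.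
Proof.
move=> hg nu; have mcube := measurable_cube.
have hcube n : g%:E * (nu (cube n) * nu (cube n)) <= energy K nu nu.
  apply: le_trans (le_energy_restr mK K0 nu (measurable_cube n)).
  have := @energy_homogeneous_bound R d K mK K0 (cube n) g _ (mrestr nu (measurable_cube n)).
  rewrite /= /mrestr setTI setICl measure0; apply => // eta etaQ.
  rewrite -(energy_translate eta (- const_mx n%:R)%R mK K0); apply: (hg (2 * n)%N).
  apply: (subset_measure0 (B := ~` cube n)) etaQ => //=.
  - apply: (measurable_preimage (measurable_translate _)).
    by apply: measurableC; exact: measurable_box.
  - exact: measurableC.
  move=> x /= nb cx; apply: nb => i; rewrite opprK !mxE.
  by have := cx i; rewrite ler_norml natrM => /andP[h1 h2]; apply/andP; split; lra.
have := energy_ge0 K0 nu nu; case: (energy K nu nu) hcube => [e| |]//; last first.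
  by move=> _ _; exact: leey.
move=> hcube _; rewrite lee_fin.
apply: (@ler_cvg_to _ \oo _ _ (fun n => g * (fine (nu (cube n)) * fine (nu (cube n))))%R
   (cst e)).
- rewrite -[X in _ --> X]mulr1; apply: cvgM; first exact: cvg_cst.
  by rewrite -[X in _ --> X]mulr1; apply: cvgM; exact: cvg_cube.
- exact: cvg_cst.
apply: nearW => n; rewrite -lee_fin.
have fE : (fine (nu (cube n)))%:E = nu (cube n) by rewrite fineK// fin_num_measure.
by rewrite EFinM [X in _ * X]EFinM fE; exact: hcube.
Qed.

Hypothesis Ke : forall x, K x = K (- x)%R.
Hypothesis Klsc : lower_semicontinuous K.
Variable R6 : R.
Hypothesis R6_gt0 : (0 < R6)%R.
Hypothesis Kincr : forall (k : 'I_d) (x y : T),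
  (forall j, j != k -> x ord0 j = y ord0 j) ->
  (R6 <= x ord0 k)%R -> (x ord0 k < y ord0 k)%R -> K x < K y.

(** The box of side b contains both the box of [confined_translate] and one on which
    energies below c occur, so its minimiser is at least as good as that of every
    larger box. *)
Lemma exists_global_minimiser (c A D0 : R) (rho : probability T R) :
  (c < A)%R -> (forall (x : T) (i : 'I_d), (D0 <= `|x ord0 i|)%R -> A%:E <= K x) ->
  energy K rho rho < c%:E ->
  exists mu : probability T R, forall nu : probability T R,
    energy K mu mu <= energy K nu nu.
Proof.
move=> cA Kfar rhoc.
have c0 : (0 < c)%R by rewrite -lte_fin (le_lt_trans _ rhoc)// energy_ge0.
have A0 : (0 < A)%R by exact: lt_trans cA.
have [M0 [rho0 [rho0Q rho0c]]] : exists M : nat, exists eta : probability T R,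
    eta (~` box M%:R) = 0 /\ energy K eta eta < c%:E.
  apply: contrapT => h; move: rhoc; apply/negP; rewrite -leNgt.
  apply: energy_ge_boxes => M eta etaQ; rewrite leNgt; apply/negP => etac.
  by apply: h; exists M, eta.
pose D := Num.max D0 (R6 + R6)%R.
have R6D : (R6 + R6 <= D)%R by rewrite le_max lexx orbT.
have D_ge0 : (0 <= D)%R by rewrite (le_trans _ R6D)// addr_ge0// ltW.
have KfarD (x : T) (i : 'I_d) : (D <= `|x ord0 i|)%R -> A%:E <= K x.
  by move=> Dx; apply: (Kfar x i); rewrite (le_trans _ Dx)// le_max lexx.
have m0 : (0 < 1 - c / A)%R by rewrite subr_gt0 ltr_pdivrMr// mul1r.
pose l := (Num.truncn (1 - c / A)^-1).+1.
have l_large : (1 < l%:R * (1 - c / A))%R.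
  by rewrite -ltr_pdivrMr// mul1r; exact: truncnS_gt.
pose b := Num.max ((3 * l)%:R * D)%R M0%:R.
have b0 : (0 <= b)%R by rewrite le_max ler0n orbT.
have [mu [muQ mumin]] := exists_box_minimiser mK K0 Klsc b0.
have bM0 : (M0%:R <= b)%R by rewrite le_max lexx orbT.
have muc : energy K mu mu < c%:E.
  by apply: le_lt_trans rho0c; apply: mumin; exact: box_concentrated rho0Q.
exists mu.
pose g := fine (energy K mu mu).
have gE : energy K mu mu = g%:E.
  rewrite fineK// ge0_fin_numE ?energy_ge0//; exact: lt_trans muc (ltry _).
rewrite gE; apply: energy_ge_boxes => M eta etaQ.
pose a : R := Num.max M%:R M0%:R.
have a0 : (0 <= a)%R by rewrite le_max ler0n.
have [muM [muMQ muMmin]] := exists_box_minimiser mK K0 Klsc a0.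
apply: (@le_trans _ _ (energy K muM muM)); last first.
  by apply: muMmin; apply: box_concentrated etaQ; rewrite le_max lexx.
have muMc : energy K muM muM < c%:E.
  apply: le_lt_trans rho0c; apply: muMmin; apply: box_concentrated rho0Q.
  by rewrite le_max lexx orbT.
pose f := fine (energy K muM muM).
have fE : energy K muM muM = f%:E.
  rewrite fineK// ge0_fin_numE ?energy_ge0//; exact: lt_trans muMc (ltry _).
have fc : (f < c)%R by rewrite -lte_fin -fE.
have muMmin' (nu : probability T R) : nu (~` box a) = 0 -> f%:E <= energy K nu nu.
  by rewrite -fE; exact: muMmin.
have [nu [nuQ nuf]] := confined_translate mK K0 Ke R6_gt0 Kincr R6D A0 KfarD muMQ fE muMmin' fc l_large.
rewrite fE -nuf -gE; apply: mumin; apply: box_concentrated nuQ.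
by rewrite le_max lexx.
Qed.

End GlobalMinimiser.
(** * Lebesgue measure and a measure of finite energy *)

Section LebesgueTranslation.
Context {R : realType}.

Lemma lebesgue_measure_translate (v : R) (A : set (measurableTypeR R)) : measurable A ->
  lebesgue_measure ((fun x : measurableTypeR R => (x + v)%R) @^-1` A) = lebesgue_measure A.
Proof.
move=> mA.
have mf : measurable_fun setT (fun x : measurableTypeR R => (x + v)%R : measurableTypeR R).
  by apply: measurable_funD.
suff : @lebesgue_measure R A = pushforward lebesgue_measure
  (fun x : measurableTypeR R => (x + v)%R : measurableTypeR R) A by move=> ->.
apply: lebesgue_measure_unique => //= _ [[a b]] _ <-.
rewrite /pushforward (_ : _ @^-1` _ = `]a - v, b - v]%classic)%R; last first.
  by apply/seteqP; split => x /=; rewrite !in_itv/= ltrBlDr lerBrDr.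
by rewrite !lebesgue_measure_itv/= !lte_fin ltrD2r opprD opprK -!EFinD addrACA addNr addr0.
Qed.

Lemma ge0_integral_translate (v : R) (f : R -> \bar R) :
  measurable_fun [set: measurableTypeR R] f -> (forall x, 0 <= f x) ->
  \int[lebesgue_measure]_x f (x + v)%R = \int[lebesgue_measure]_x f x.
Proof.
move=> mf f0.
have mv : measurable_fun setT (fun x : measurableTypeR R => (x + v)%R : measurableTypeR R).
  by apply: measurable_funD.
rewrite -(@ge0_integral_pushforward _ _ _ _ R _ mv lebesgue_measure setT f)//.
by apply: eq_measure_integral => A mA _; exact: lebesgue_measure_translate.
Qed.

Lemma lebesgue_rV_translate n (v : 'rV[R]_n) (A : set 'rV[R]_n) : measurable A ->
  lebesgue_rV R n ((fun x => x + v)%R @^-1` A) = lebesgue_rV R n A.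
Proof.
elim: n v A => [|n IH] v A mA.
  by rewrite (_ : _ @^-1` A = A)//; apply/seteqP; split => x /=; rewrite [(x + v)%R]thinmx0 [x]thinmx0.
pose B := @cons_rV R n @^-1` A.
have mB : measurable B by exact: measurable_preimage (@measurable_cons_rV R n) mA.
pose v0 := v ord0 ord0.
pose v' : 'rV[R]_n := (\row_i v ord0 (lift ord0 i))%R.
have BE : @cons_rV R n @^-1` ((fun x => x + v)%R @^-1` A) =
    (fun p : measurableTypeR R * 'rV[R]_n => (p.1 + v0, p.2 + v')%R) @^-1` B.
  apply/seteqP; split => -[a x]; rewrite /B /=; congr A;
    by apply/rowP => i; rewrite !mxE; case: unliftP => [j|] -> /=; rewrite ?mxE.
change ((@lebesgue_measure R \x lebesgue_rV R n)
   (@cons_rV R n @^-1` ((fun x => x + v)%R @^-1` A)) =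
  (@lebesgue_measure R \x lebesgue_rV R n) B).
rewrite BE /product_measure1.
rewrite -[RHS](ge0_integral_translate v0).
- apply: eq_integral => a _ /=.
  rewrite -[RHS](IH v'); last exact: measurable_xsection.
  congr (lebesgue_rV R n _); apply/seteqP; split => x; rewrite /xsection /= !inE//.
- exact: measurable_fun_xsection.
- by move=> x /=.
Qed.

Lemma ge0_integral_rV_translate n (v : 'rV[R]_n) (f : 'rV[R]_n -> \bar R) :
  measurable_fun setT f -> (forall x, 0 <= f x) ->
  \int[lebesgue_rV R n]_x f (x - v)%R = \int[lebesgue_rV R n]_x f x.
Proof.
move=> mf f0; have mv := measurable_translate v.
rewrite -(@ge0_integral_pushforward _ _ _ _ R _ mv (lebesgue_rV R n) setT f)//.
by apply: eq_measure_integral => A mA _; exact: lebesgue_rV_translate.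
Qed.

End LebesgueTranslation.
Section FiniteEnergy.
Context {R : realType} {d : nat}.
Local Notation T := 'rV[R]_d.
Local Notation leb := (lebesgue_rV R d).

Lemma lebesgue_box1 : leb (box 1) = 1.
Proof.
have -> : box 1 = [set x : T | forall i, (`[0%R, 1%R]%classic : set R) (x ord0 i)].
  by apply/seteqP; split => x /= + i => /(_ i); rewrite in_itv/=.
rewrite (@lebesgue_rV_box R d (fun=> `[0%R, 1%R]%classic)); last first.
  by move=> i; exact: measurable_itv.
rewrite big1// => i _; rewrite lebesgue_measure_itv/= lte_fin ltr01.
by rewrite oppr0 adde0.
Qed.

Lemma lebesgue_cube1_lty : leb (cube 1) < +oo.
Proof.
have -> : cube 1 = [set x : T | forall i,
    (`[(- 1)%R, 1%R]%classic : set R) (x ord0 i)].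
  by apply/seteqP; split => x /= + i => /(_ i); rewrite in_itv/= ler_norml.
rewrite (@lebesgue_rV_box R d (fun=> `[(- 1)%R, 1%R]%classic)); last first.
  by move=> i; exact: measurable_itv.
rewrite (eq_bigr (fun=> (1 + 1)%:E)) ?prodEFin ?ltry// => i _.
by rewrite lebesgue_measure_itv/= lte_fin gtrN// opprK.
Qed.

Lemma cube1_eball : cube 1 `<=` (eball 0 (d%:R + 1)%R : set T).
Proof.
move=> x cx; rewrite /eball /= subr0 /enorm.
have d1 : (0 < d%:R + 1 :> R)%R by rewrite ltr_wpDl.
rewrite -[ltRHS](ger0_norm (ltW d1)) -sqrtr_sqr ltr_sqrt ?exprn_gt0//.
apply: (@le_lt_trans _ _ (\sum_(i < d) 1)%R).
  apply: ler_sum => i _; rewrite -real_normK ?num_real//.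
  by rewrite expr_le1// cx.
rewrite sumr_const card_ord; have := ler0n R d; nra.
Qed.

Lemma measurable_eball (c : T) (r : R) : measurable (eball c r).
Proof.
have mf : measurable_fun setT (fun x : T => enorm (x - c)%R).
  apply: (measurableT_comp (continuous_measurable_fun (@sqrt_continuous R))).
  apply: measurable_sum => i; under eq_fun do rewrite !mxE.
  apply: measurable_funX; apply: measurable_funB => //; exact: measurable_coord.
have := measurable_preimage mf (measurable_itv `]-oo, r[).
by congr measurable; apply/seteqP; split => x /=; rewrite in_itv.
Qed.

Variable K : T -> \bar R.
Hypothesis mK : measurable_fun setT K.
Hypothesis K0 : forall x, 0 <= K x.
Hypothesis Ke : forall x, K x = K (- x)%R.

(** For Lebesgue measure on the unit box, the potential at a point x of the box is
    the integral of K over a translate of the box, which lies in the cube of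
    half-side 1. *)
Lemma finite_energy : \int[leb]_(x in cube 1) K x < +oo ->
  exists nu : probability T R, energy K nu nu < +oo.
Proof.
move=> Kfin.
have mC := @measurable_box R d 1.
pose m : {measure set T -> \bar R} := mrestr leb mC.
have mT : m setT = 1 by rewrite /m /= /mrestr setTI; exact: lebesgue_box1.
pose nu : probability T R := mnormalize m \d_(0%R : T).
have nuE : (nu : set T -> \bar R) = m.
  apply/funext => A; rewrite /nu /= /mnormalize mT onee_eq0/=.
  by rewrite invr1 mule1.
exists nu.
have mp : measurable_fun setT (potential K m) by rewrite -nuE; exact: measurable_potential.
have pot_le x : box 1 x -> potential K m x <= \int[leb]_(z in cube 1) K z.
  move=> bx.
  rewrite /potential (integral_mrestr _ mC)//; last first.
    exact: measurable_kernel_l.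
  pose g : T -> \bar R := K \_ (cube 1).
  have mg : measurable_fun setT g.
    by apply/(measurable_restrictT _ (measurable_cube 1)); exact: measurable_funTS.
  have g0 z : 0 <= g z by rewrite /g /patch; case: ifP.
  rewrite [leRHS]integral_mkcond -(ge0_integral_rV_translate x mg g0).
  rewrite [leLHS]integral_mkcond; apply: ge0_le_integral => //.
  - by move=> y _; rewrite /patch; case: ifP.
  - apply/(measurable_restrictT _ mC); apply: measurable_funTS.
    exact: measurable_kernel_l.
  - exact: (measurableT_comp mg (measurable_translate x)).
  move=> y _; rewrite /g /patch; case: ifPn => yb; last by case: ifP.
  rewrite mem_set; first by rewrite Ke opprB.
  move=> i; rewrite !mxE; rewrite inE in yb.
  have /andP[x0 x1] := bx i; have /andP[y0 y1] := yb i.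
  by rewrite ler_norml; apply/andP; split; lra.
rewrite nuE /energy (integral_mrestr _ mC)//; last first.
  move=> x; exact: potential_ge0.
apply: (@le_lt_trans _ _ (\int[leb]_(x in box 1) (\int[leb]_(z in cube 1) K z))).
  apply: ge0_le_integral => //.
  - by move=> x _; exact: potential_ge0.
  - exact: measurable_funTS.
rewrite integral_cst// [X in _ * X]lebesgue_box1 mule1.
exact: Kfin.
Qed.

End FiniteEnergy.
(** * Energy of a minimiser *)

Section Necessity.
Context {R : realType} {d : nat}.
Local Notation T := 'rV[R]_d.
Variable K : T -> \bar R.
Hypothesis mK : measurable_fun setT K.
Hypothesis K0 : forall x, 0 <= K x.
Hypothesis Ke : forall x, K x = K (- x)%R.
Variables (R6 w : R) (k : 'I_d).
Hypothesis Kle : forall x : T, (R6 <= `|x ord0 k|)%R -> K x <= w%:E.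

(** With a the mass of the cube, the truncated measure together with its translate
    has mass 2 a and energy at most 2 f + 2 w a^2; let a tend to 1. *)
Lemma minimiser_energy_le (rho : probability T R) (f : R) :
  energy K rho rho = f%:E ->
  (forall nu : probability T R, f%:E <= energy K nu nu) -> (f <= w)%R.
Proof.
move=> rhof fmin.
have w0 : (0 <= w)%R.
  rewrite -lee_fin; apply: le_trans (K0 (const_mx R6)) _; apply: Kle.
  by rewrite mxE ler_norm.
suff h n : (f * (4 * (fine (rho (cube n)) ^+ 2)) <= 2 * f + 2 * w * fine (rho (cube n)) ^+ 2)%R.
  have : (f * (4 * (1 ^+ 2)) <= 2 * f + 2 * w * 1 ^+ 2)%R.
    have c1 := cvg_cube rho.
    have c2 : (fine (rho (cube n)) ^+ 2)%R @[n --> \oo] --> ((1%R : R) ^+ 2)%R.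
      rewrite expr2; apply: cvg_trans (cvgM c1 c1).
      by apply: near_eq_cvg; apply: nearW => n; rewrite expr2.
    pose u n := (fine (rho (cube n)) ^+ 2)%R.
    apply: (@ler_cvg_to _ \oo _ R (fun n => f * (4 * u n))%R (fun n => 2 * f + 2 * w * u n)%R).
    - by apply: cvgM; [exact: cvg_cst|apply: cvgM => //; exact: cvg_cst].
    - by apply: cvgD; [exact: cvg_cst|apply: cvgM => //; exact: cvg_cst].
    - exact: nearW.
  by rewrite expr1n; lra.
have mA : measurable (cube n : set T) by exact: measurable_cube.
(* After a translation by s along the k-th axis, points of the two cubes differ
   by at least R6 in that coordinate. *)
pose s : R := (2 * n%:R + R6)%R.
pose v : T := (\row_i - (s *+ (i == k)))%R.
pose B : set T := translate (- v)%R @^-1` (cube n).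
have mB : measurable B by exact: (measurable_preimage (measurable_translate _)).
pose rho' : probability T R := distribution rho (translate v).
have rho'f : energy K rho' rho' = f%:E by rewrite energy_translate.
have rho'B : rho' B = rho (cube n).
  rewrite /rho' /= /distribution /= /pushforward /B -comp_preimage.
  by congr (rho _); apply/seteqP; split => x /=; rewrite opprK subrK.
pose m1 : {finite_measure set T -> \bar R} := mrestr rho mA.
pose m2 : {finite_measure set T -> \bar R} := mrestr rho' mB.
pose mm : {finite_measure set T -> \bar R} := measure_add m1 m2.
have [a aE] : exists a, rho (cube n) = a%:E.
  by exists (fine (rho (cube n))); rewrite fineK// fin_num_measure.
have m1T : m1 setT = a%:E by rewrite /m1 /= /mrestr setTI.
have m2T : m2 setT = a%:E by rewrite /m2 /= /mrestr setTI rho'B.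
have := energy_homogeneous_bound mK K0 (Q := setT) (f := f) (fun nu _ => fmin nu) (m := mm) _.
rewrite setCT measure0 => /(_ erefl).
have -> : mm setT = (a + a)%:E.
  by apply: etrans (measure_addE m1 m2 setT) _; rewrite [X in X + _]m1T [X in _ + X]m2T.
have E11 : energy K m1 m1 <= f%:E by rewrite -rhof; exact: le_energy_restr.
have E22 : energy K m2 m2 <= f%:E by rewrite -rho'f; exact: le_energy_restr.
have E12 : energy K m1 m2 <= (w * (a * a))%:E.
  rewrite energy_restrl//.
  apply: (@le_trans _ _ (\int[rho]_(x in cube n) (w * a)%:E)).
    apply: ge0_le_integral => //.
    - by move=> x _; exact: potential_ge0.
    - by apply: measurable_funTS; exact: measurable_potential.
    move=> x cx; rewrite potential_restr//.
    apply: (@le_trans _ _ (\int[rho']_(y in B) w%:E)).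
      apply: ge0_le_integral => //.
        by apply: measurable_funTS; exact: measurable_kernel_l.
      move=> y /(_ k); rewrite /B /= opprK !mxE eqxx mulr1n => yk.
      apply: Kle; rewrite !mxE; have := cx k.
      move: yk; rewrite !ler_norml => /andP[y1 y2] /andP[x1 x2].
      by rewrite distrC ler_normr; apply/orP; left; rewrite /s in y1; lra.
    by rewrite integral_cst// [X in _ * X]rho'B aE EFinM.
  by rewrite integral_cst// [X in _ * X]aE -EFinM mulrA.
have -> : energy K mm mm = energy K m1 m1 + energy K m1 m2 + (energy K m2 m1 + energy K m2 m2).
  by rewrite [LHS](energy_addl mK K0 m1 m2) !(energy_addr mK K0 _ m1 m2).
rewrite (energyC mK K0 m2 m1 Ke) => /le_trans h.
have := h _ (leeD (leeD E11 E12) (leeD E12 E22)).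
rewrite -!(EFinM, EFinD) lee_fin aE /= => {}h.
move: h; rewrite -subr_ge0 => h; rewrite -subr_ge0; move: h; congr (0 <= _)%R; ring.
Qed.

End Necessity.
(** * Reduction to a nonnegative kernel *)

(** Adding a constant under the integral when f need not be integrable: only its
    negative part is known to have a finite integral. *)
Lemma integral_shift {dd : measure_display} {X : measurableType dd} {R : realType}
    (M : {measure set X -> \bar R}) (f : X -> \bar R) (b : R) :
  M setT = 1 -> measurable_fun setT f -> (0 <= b)%R ->
  (forall x, (- b)%:E <= f x) ->
  \int[M]_x f x = \int[M]_x (f x + b%:E) + (- b)%:E.
Proof.
move=> M1 mf b0 fb.
have mfp : measurable_fun setT (f^\+) by exact: measurable_funepos.
have mfn : measurable_fun setT (f^\-) by exact: measurable_funeneg.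
have mg : measurable_fun setT (fun x => f x + b%:E).
  by apply: emeasurable_funD => //; exact: measurable_cst.
have g0 x : 0 <= f x + b%:E by rewrite -leeBlDr// sub0e; exact: fb.
have nb x : f^\- x <= b%:E.
  by rewrite funenegE ge_max leeNl -EFinN fb lee_fin.
have In : \int[M]_x f^\- x \is a fin_num.
  rewrite ge0_fin_numE ?integral_ge0//.
  apply: (@le_lt_trans _ _ (\int[M]_x b%:E)); first exact: ge0_le_integral.
  by rewrite integral_cst// [X in _ * X]M1 mule1 ltry.
have key : \int[M]_x f^\+ x + b%:E = \int[M]_x (f x + b%:E) + \int[M]_x f^\- x.
  have e1 : \int[M]_x (f^\+ x + b%:E) = \int[M]_x f^\+ x + b%:E.
    by rewrite ge0_integralD// integral_cst// [X in _ * X]M1 mule1.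
  rewrite -e1 -ge0_integralD//; apply: eq_integral => x _.
  have fx : f x = f^\+ x - f^\- x by rewrite [in LHS](funeposneg f).
  rewrite fx; have := nb x; have := funeneg_ge0 f x.
  case: (f^\- x) => [r| |]// _ _.
  by rewrite addeAC subeK.
rewrite integralE.
have -> : \int[M]_x f^\+ x = \int[M]_x (f x + b%:E) + \int[M]_x f^\- x - b%:E.
  by rewrite -key addeK.
by rewrite addeAC addeK// EFinN.
Qed.

Section BehaviourAtInfinity.
Context {R : realType} {d : nat}.
Local Notation T := 'rV[R]_d.
Variable W : T -> \bar R.
Hypothesis We : forall x, W x = W (- x)%R.
Variables (R6 : R) (Winf : \bar R).
Hypothesis Wincr : forall (k : 'I_d) (x y : T),
  (forall j, j != k -> x ord0 j = y ord0 j) ->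
  (R6 <= x ord0 k)%R -> (x ord0 k < y ord0 k)%R -> W x < W y.
Hypothesis Wlim : W x @[x --> enorm_infty R d] --> Winf.

Lemma coord_le_enorm (x : T) (i : 'I_d) : (`|x ord0 i| <= enorm x)%R.
Proof.
rewrite /enorm -sqrtr_sqr ler_wsqrtr// (bigD1 i)//= lerDl.
by apply: sumr_ge0 => j _; exact: sqr_ge0.
Qed.

(** Along the ray x + t e_k the function W increases strictly and tends to its limit. *)
Lemma le_limit (k : 'I_d) (x : T) : (R6 <= `|x ord0 k|)%R -> W x <= Winf.
Proof.
wlog xk : x / (0 <= x ord0 k)%R.
  move=> wl; have [x0|x0] := leP 0%R (x ord0 k); first exact: wl.
  move=> xR; rewrite We; apply: wl; rewrite !mxE ?normrN//.
  by rewrite oppr_ge0 ltW.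
rewrite ger0_norm// => xR; rewrite leNgt; apply/negP => Wx.
have /Wlim[r _ hr] : nbhs Winf [set e | e < W x].
  exact: open_ereal_lt'.
pose y : T := (\row_i (x ord0 i + (1 + `|r|) *+ (i == k)))%R.
have yr : (r < enorm y)%R.
  apply: lt_le_trans (coord_le_enorm y k).
  rewrite !mxE eqxx mulr1n (lt_le_trans _ (ler_norm _))//.
  by have := ler_norm r; lra.
have := hr y yr; rewrite /= ltNge => /negP; apply; apply: ltW.
apply: (Wincr (k := k)) => //.
  by move=> j jk; rewrite mxE (negbTE jk) mulr0n addr0.
by rewrite mxE eqxx mulr1n ltrDl; have := normr_ge0 r; lra.
Qed.

Lemma ge_far (A : R) : A%:E < Winf ->
  exists D0 : R, forall (x : T) (i : 'I_d), (D0 <= `|x ord0 i|)%R -> A%:E <= W x.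
Proof.
move=> AW.
have /Wlim[r _ hr] : nbhs Winf [set e | A%:E < e].
  exact: open_ereal_gt'.
exists (r + 1)%R => x i xi; apply: ltW; apply: hr => /=.
apply: lt_le_trans (coord_le_enorm x i); apply: lt_le_trans xi.
by rewrite ltrDl.
Qed.

End BehaviourAtInfinity.
Section Reduction.
Context {R : realType} {d : nat}.
Local Notation T := 'rV[R]_d.
Variable W : T -> \bar R.
Hypothesis mW : measurable_fun setT W.
Variable Wmin : R.
Hypothesis Wmin_lt0 : (Wmin < 0)%R.
Hypothesis W_ge : forall x, Wmin%:E <= W x.

Definition lifted (x : T) : \bar R := W x + (- Wmin)%:E.

Lemma measurable_lifted : measurable_fun setT lifted.
Proof. by apply: emeasurable_funD => //; exact: measurable_cst. Qed.

Lemma lifted_ge0 x : 0 <= lifted x.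
Proof. by rewrite /lifted EFinN sube_ge0 ?W_ge// orbT. Qed.

Lemma lt_lifted x y : (lifted x < lifted y) = (W x < W y).
Proof. by rewrite /lifted lteD2rE. Qed.

Lemma lifted_lsc : lower_semicontinuous W -> lower_semicontinuous lifted.
Proof.
move=> lsc x a; rewrite /lifted EFinN lteBrDr// -EFinD => /lsc[V xV VW].
by exists V => // y /VW; rewrite lteBrDr// -EFinD.
Qed.

Lemma interaction_energyE (rho : probability T R) :
  interaction_energy W rho = (2^-1)%:E * (energy lifted rho rho + Wmin%:E).
Proof.
rewrite /interaction_energy; congr (_ * _).
rewrite (energyE measurable_lifted lifted_ge0).
rewrite (@integral_shift _ _ _ (rho \x rho) _ (- Wmin)%R) ?opprK//.
- rewrite -setXTT; apply: etrans (product_measure1E rho rho measurableT measurableT) _.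
  by rewrite [X in X * _]probability_setT [X in _ * X]probability_setT mule1.
- exact: measurable_kernel.
- by rewrite oppr_ge0 ltW.
Qed.

Lemma le_interaction_energy (rho nu : probability T R) :
  (interaction_energy W rho <= interaction_energy W nu) =
  (energy lifted rho rho <= energy lifted nu nu).
Proof.
by rewrite !interaction_energyE lee_pmul2l// ?leeD2rE// lte_fin invr_gt0.
Qed.

Lemma interaction_energy_le (rho : probability T R) (w : \bar R) :
  (interaction_energy W rho <= (2^-1)%:E * w) =
  (energy lifted rho rho <= w - Wmin%:E).
Proof.
by rewrite interaction_energyE lee_pmul2l ?lte_fin ?invr_gt0// leeBrDr.
Qed.

Lemma lifted_locally_integrable :
  (forall (c : T) (r : R), (0 < r)%R ->
    \int[lebesgue_rV R d]_(x in eball c r) `|W x| < +oo) ->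
  \int[lebesgue_rV R d]_(x in cube 1) lifted x < +oo.
Proof.
move=> Wloc; have mc : measurable (cube 1 : set T) by exact: measurable_cube.
have mWa : measurable_fun setT (fun x : T => `|W x|) by exact: measurableT_comp.
apply: (@le_lt_trans _ _ (\int[lebesgue_rV R d]_(x in cube 1) (`|W x| + (- Wmin)%:E))).
  apply: ge0_le_integral => //.
  - by move=> x _; exact: lifted_ge0.
  - by apply: measurable_funTS; exact: measurable_lifted.
  - by apply: measurable_funTS; apply: emeasurable_funD => //; exact: measurable_cst.
  - by move=> x _; rewrite /lifted leeD2r// lee_abs.
have W0 : (0 <= - Wmin)%R by rewrite oppr_ge0 ltW.
rewrite ge0_integralD//; last exact: measurable_funTS.
rewrite integral_cst//; apply: lte_add_pinfty.
  have d1 : (0 < d%:R + 1 :> R)%R by rewrite ltr_wpDl.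
  apply: le_lt_trans (Wloc 0%R _ d1).
  apply: ge0_subset_integral => //; first exact: measurable_eball.
    exact: measurable_funTS.
  exact: cube1_eball.
apply: lte_mul_pinfty => //; exact: lebesgue_cube1_lty.
Qed.

End Reduction.

Unset Implicit Arguments.
Set Strict Implicit.

Theorem theorem3p3 (R : realType) (d : nat) (d_ge1 : (1 <= d)%N)
    (W : 'rV[R]_d -> \bar R)
    (W_measurable : measurable_fun [set: 'rV[R]_d] W)
    (Wmin : R) (Wmin_lt0 : (Wmin < 0)%R)
    (W_bounded_below : forall x, Wmin%:E <= W x)
    (W_locally_integrable : forall (c : 'rV[R]_d) (r : R), (0 < r)%R ->
      \int[lebesgue_rV R d]_(x in eball c r) `|W x| < +oo)
    (W_even : forall x, W x = W (- x)%R)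
    (W_lsc : lower_semicontinuous W)
    (R6 : R) (R6_gt0 : (0 < R6)%R)
    (W_increasing : forall (k : 'I_d) (x y : 'rV[R]_d),
      (forall j, j != k -> x ord0 j = y ord0 j) ->
      (R6 <= x ord0 k)%R -> (x ord0 k < y ord0 k)%R -> W x < W y)
    (Winf : \bar R) (W_limit : W x @[x --> enorm_infty R d] --> Winf)
    (Wtilde_pos_integrable : Winf < +oo ->
      (lebesgue_rV R d).-integrable [set: 'rV[R]_d]
        (fun x => W x - Winf)^\+) :
  (exists rho : probability 'rV[R]_d R, is_global_minimiser W rho) <->
  (exists rho : probability 'rV[R]_d R,
     interaction_energy W rho <= (2^-1)%:E * Winf).
Proof.
pose K := lifted W Wmin.
have mK : measurable_fun setT K by exact: measurable_lifted.
have K0 : forall x, 0 <= K x by move=> x; exact: lifted_ge0.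
have Ke x : K x = K (- x)%R by rewrite /K /lifted W_even.
have Kloc : \int[lebesgue_rV R d]_(x in cube 1) K x < +oo.
  exact: lifted_locally_integrable.
have energy_le := interaction_energy_le W_measurable Wmin_lt0 W_bounded_below.
have le_energy := le_interaction_energy W_measurable Wmin_lt0 W_bounded_below.
pose k0 : 'I_d := Ordinal d_ge1.
have WleWinf (x : 'rV[R]_d) : (R6 <= `|x ord0 k0|)%R -> W x <= Winf.
  exact: (le_limit W_even W_increasing W_limit).
split => [[rho rhomin]|[rho0 rho0W]].
  exists rho; rewrite energy_le.
  have Kmin (nu : probability 'rV[R]_d R) : energy K rho rho <= energy K nu nu.
    by have := rhomin nu; rewrite le_energy.
  have [nu nufin] := finite_energy mK K0 Ke Kloc.
  have rhofin : energy K rho rho \is a fin_num.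
    by rewrite ge0_fin_numE ?energy_ge0//; exact: le_lt_trans (Kmin nu) nufin.
  case: Winf {W_limit Wtilde_pos_integrable} WleWinf => [w| |] WleWinf; last 2 first.
  - by rewrite addye// leey.
  - have xR : (R6 <= `|(const_mx R6 : 'rV[R]_d) ord0 k0|)%R by rewrite mxE ler_norm.
    have := le_trans (W_bounded_below _) (WleWinf _ xR).
    by rewrite leeNy_eq.
  rewrite -[leLHS](fineK rhofin) -EFinB lee_fin.
  apply: (@minimiser_energy_le R d K mK K0 Ke R6 _ k0 _ rho).
  - by move=> x xR; rewrite /K /lifted EFinB EFinN leeD2r// WleWinf.
  - by rewrite fineK.
  - by move=> mu; rewrite fineK.
have [[rho rhoW]|none] := pselect (exists rho : probability 'rV[R]_d R,
    energy K rho rho < Winf - Wmin%:E); last first.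
  exists rho0 => nu; rewrite le_energy.
  rewrite energy_le in rho0W; apply: le_trans rho0W _.
  by rewrite leNgt; apply/negP => h; apply: none; exists nu.
have [c [A [rhoc cA AW]]] : exists c A : R,
    [/\ energy K rho rho < c%:E, (c < A)%R & A%:E < Winf - Wmin%:E].
  have := energy_ge0 K0 rho rho.
  move: rhoW; case: (energy K rho rho) => [e| |]//; last first.
    by rewrite ltNge leey.
  case: (Winf - Wmin%:E) => [w| |]// ew _; last first.
    exists (e + 1)%R, (e + 2)%R; split; [|lra|exact: ltry].
    by rewrite lte_fin ltrDl.
  rewrite lte_fin in ew.
  exists (e + (w - e) / 3)%R, (e + 2 * (w - e) / 3)%R; rewrite !lte_fin.
  by split; lra.
have AW' : (A + Wmin)%:E < Winf by rewrite EFinD -lteBrDr.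
have [D0 D0P] := ge_far W_limit AW'.
have [mu mumin] : exists mu : probability 'rV[R]_d R, forall nu : probability 'rV[R]_d R,
    energy K mu mu <= energy K nu nu.
  apply: (@exists_global_minimiser R d K mK K0 Ke _ R6 R6_gt0 _ c A D0 rho) => //.
  - exact: lifted_lsc.
  - by move=> k x y xy xR xyk; rewrite lt_lifted; exact: W_increasing xy xR xyk.
  - by move=> x i xi; rewrite /K /lifted EFinN leeBrDr// -EFinD; exact: D0P xi.
by exists mu => nu; rewrite le_energy.
Qed.
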